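(* Let $R$ be an associative ring with identity, $Q$ a left rooted quiver, and $m\in\mathbb{Z}_{\geq 0}$. Let $(\mathcal{X},\omega)$ be a Frobenius pair in the category ${}_R\mathsf{Mod}$ of left $R$-modules such that $(\omega^\wedge_m,[\omega^\wedge_m]^{\perp_1})$ is a complete cotorsion pair in ${}_R\mathsf{Mod}$ (in particular, the Frobenius pair is $\omega^\wedge_m$-complete in $\mathcal{X}^{\perp_1}$). Then $$(\Phi(\mathcal{X}^\wedge_m),\ \Phi(\omega^\wedge_m)\cap\mathrm{Rep}(Q,[\omega^\wedge_m]^{\perp_1}))$$ is a Frobenius pair in the category $\mathrm{Rep}(Q,{}_R\mathsf{Mod})$ of ${}_R\mathsf{Mod}$-valued representations of $Q$.
   Context: In an abelian category: $\mathcal{X}^{\perp_1}=\{N: \mathrm{Ext}^1(X,N)=0\ \forall X\in\mathcal X\}$, ${}^{\perp_1}\mathcal X$ is dual. $\mathcal{X}^\wedge_m$ is the class of objects $M$ having an exact sequence $0\to X_m\to\cdots\to X_0\to M\to 0$ with all $X_i\in\mathcal{X}$. $A\rightarrowtail B\twoheadrightarrow C$ denotes a short exact sequence. A (left) Frobenius pair $(\mathcal{X},\omega)$ in an abelian category: $\mathcal{X}$ is closed under extensions, kernels of epimorphisms between its objects, and direct summands; $\omega$ is closed under direct summands; $\mathrm{Ext}^i(X,W)=0$ for all $X\in\mathcal X$, $W\in\omega$, $i>0$; $\omega\subseteq\mathcal X$ and every $X\in\mathcal X$ admits a short exact sequence $X\rightarrowtail W\twoheadrightarrow X'$ with $W\in\omega$,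 $X'\in\mathcal X$. It is $\omega^\wedge_m$-complete in $\mathcal{X}^{\perp_1}$ if for every $M\in\mathcal{X}^{\perp_1}$ there exist short exact sequences $K'\rightarrowtail L\twoheadrightarrow M$ and $M\rightarrowtail K\twoheadrightarrow L'$ with $L,L'\in\omega^\wedge_m$ and $K,K'\in[\omega^\wedge_m]^{\perp_1}$. A cotorsion pair $(\mathcal A,\mathcal D)$: $\mathcal A^{\perp_1}=\mathcal D$ and $\mathcal A={}^{\perp_1}\mathcal D$; it is complete if every object $C$ has short exact sequences $D\rightarrowtail A\twoheadrightarrow C$ and $C\rightarrowtail D'\twoheadrightarrow A'$ with $A,A'\in\mathcal A$, $D,D'\in\mathcal D$. A quiver $Q=(Q_0,Q_1)$ (vertices $Q_0$, arrows $Q_1$, source $s(a)$ and target $t(a)$ of an arrow $a$) is left rooted if it contains no infinite path of the form $\cdots\to\bullet\to\bullet\to\bullet$. It is viewed as a category with objects the vertices and morphisms the paths; a representation is a covariant functor $X\colon Q\to{}_R\mathsf{Mod}$ and morphisms are natural transformations. For $i\in Q_0$, $\phi^X_i\colon\coprod_{a\in Q_1,\,t(a)=i}X(s(a))\to X(i)$ is the morphism whose component at $a$ is $X(a)$, and $C_i(X)=\mathrm{CoKer}(\phi^X_i)$. For a class $\mathcal X\subseteq{}_R\mathsf{Mod}$: $\mathrm{Rep}(Q,\mathcal X)=\{X: X(i)\in\mathcal X\ \forall i\in Q_0\}$ and $\Phi(\mathcal X)=\{X:\phi^X_i\text{ is monic and }C_i(X)\in\mathcal X\ \forall i\in Q_0\}$.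 *)

(* Defs.v *)
From HB Require Import structures.
From Stdlib Require Import Relation_Operators.
From mathcomp Require Import all_boot all_algebra.
From mathcomp Require Import boolp classical_sets functions cardinality fsbigop.
From mathcomp Require Import finmap generic_quotient ring_quotient.

Set Implicit Arguments.
Unset Strict Implicit.
Unset Printing Implicit Defensive.

Import GRing.Theory.
Local Open Scope ring_scope.
Local Open Scope quotient_scope.

#[local] Obligation Tactic := idtac.

(** * Categories, functors, natural transformations *)

Record category : Type := Category {
  obj :> Type;
  Hom : obj -> obj -> Type;
  idm : forall A, Hom A A;
  compose : forall A B D, Hom B D -> Hom A B -> Hom A D;
  comp1m : forall A B (f : Hom A B), compose (idm B) f = f;
  compm1 : forall A B (f : Hom A B), compose f (idm A) = f;
  compA : forall A B D E (h : Hom D E) (g : Hom B D) (f : Hom A B),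
    compose h (compose g f) = compose (compose h g) f }.

Arguments Hom {c} A B : rename.
Arguments idm {c} A : rename.
Arguments compose {c A B D} g f : rename.

Notation "g ∘ f" := (compose g f) (at level 40, left associativity).

(* The group operations are fields, rather than a [zmodType] structure on
   [Hom A B], so that categories of functors out of a category in an arbitrary
   universe are again of this form. *)
Record preadditive : Type := Preadditive {
  precat :> category;
  hzero : forall A B : precat, Hom A B;
  hopp : forall A B : precat, Hom A B -> Hom A B;
  hadd : forall A B : precat, Hom A B -> Hom A B -> Hom A B;
  haddA : forall A B : precat, associative (@hadd A B);
  haddC : forall A B : precat, commutative (@hadd A B);
  hadd0 : forall A B : precat, left_id (hzero A B) (@hadd A B);
  haddN : forall A B : precat, left_inverse (hzero A B) (@hopp A B) (@hadd A B);
  compDl : forall (A B D : precat) (g h : Hom B D) (f : Hom A B),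
    hadd g h ∘ f = hadd (g ∘ f) (h ∘ f);
  compDr : forall (A B D : precat) (g : Hom B D) (f h : Hom A B),
    g ∘ hadd f h = hadd (g ∘ f) (g ∘ h) }.

Arguments hzero {p A B} : rename.
Arguments hopp {p A B} f : rename.
Arguments hadd {p A B} f g : rename.

Record functor (C D : category) : Type := Functor {
  fobj :> C -> D;
  fmap : forall A B : C, Hom A B -> Hom (fobj A) (fobj B);
  fmap1 : forall A, fmap (idm A) = idm (fobj A);
  fmapM : forall (A B E : C) (g : Hom B E) (f : Hom A B),
    fmap (g ∘ f) = fmap g ∘ fmap f }.

Arguments fmap {C D} F {A B} f : rename.

Record nat_trans (C D : category) (F G : functor C D) : Type := NatTrans {
  component :> forall A, Hom (F A) (G A);
  naturality : forall (A B : C) (f : Hom A B),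
    component B ∘ fmap F f = fmap G f ∘ component A }.

Lemma nat_trans_ext (C D : category) (F G : functor C D) (s t : nat_trans F G) :
  (forall A, s A = t A) -> s = t.
Proof.
case: s t => [s sP] [t tP] /= st.
have e : s = t by apply: functional_extensionality_dep.
by case: t / e tP {st} => tP; congr NatTrans; exact: Prop_irrelevance.
Qed.

Section FunctorCategory.
Variable C : category.

Section Category.
Variable D : category.

Program Definition nt_id (F : functor C D) : nat_trans F F :=
  NatTrans (fun A B f => _) (component := fun A => idm (F A)).
Next Obligation. by move=> F A B f; rewrite comp1m compm1. Qed.

Program Definition nt_comp (F G H : functor C D)
    (t : nat_trans G H) (s : nat_trans F G) : nat_trans F H :=
  NatTrans (fun A B f => _) (component := fun A => t A ∘ s A).
Next Obligation.
by move=> F G H t s A B f; rewrite -compA naturality !compA naturality.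
Qed.

Program Definition functor_category : category :=
  @Category (functor C D) (@nat_trans C D) nt_id nt_comp _ _ _.
Next Obligation. by move=> F G s; apply: nat_trans_ext => A; exact: comp1m. Qed.
Next Obligation. by move=> F G s; apply: nat_trans_ext => A; exact: compm1. Qed.
Next Obligation.
by move=> F G H K u t s; apply: nat_trans_ext => A; exact: compA.
Qed.

End Category.

Section Preadditive.
Variable D : preadditive.

Lemma addm0 (A B : D) (f : Hom A B) : hadd f hzero = f.
Proof. by rewrite haddC hadd0. Qed.

Lemma addm_idem (A B : D) (f : Hom A B) : hadd f f = f -> f = hzero.
Proof.
by move=> /(congr1 (hadd (hopp f))); rewrite haddA haddN hadd0.
Qed.

Lemma comp0m (A B E : D) (f : Hom A B) : (hzero : Hom B E) ∘ f = hzero.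
Proof. by apply: addm_idem; rewrite -compDl hadd0. Qed.

Lemma compm0 (A B E : D) (f : Hom B E) : f ∘ (hzero : Hom A B) = hzero.
Proof. by apply: addm_idem; rewrite -compDr hadd0. Qed.

Lemma opp_uniq (A B : D) (f g : Hom A B) : hadd g f = hzero -> g = hopp f.
Proof.
move=> gf0; rewrite -[RHS]hadd0 -gf0 -haddA.
by rewrite [hadd f _]haddC haddN addm0.
Qed.

Lemma compNm (A B E : D) (g : Hom B E) (f : Hom A B) :
  hopp g ∘ f = hopp (g ∘ f).
Proof. by apply: opp_uniq; rewrite -compDl haddN comp0m. Qed.

Lemma compmN (A B E : D) (g : Hom B E) (f : Hom A B) :
  g ∘ hopp f = hopp (g ∘ f).
Proof. by apply: opp_uniq; rewrite -compDr haddN compm0. Qed.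

Program Definition nt_zero (F G : functor C D) : nat_trans F G :=
  NatTrans (fun A B f => _) (component := fun A => hzero).
Next Obligation. by move=> F G A B f; rewrite comp0m compm0. Qed.

Program Definition nt_opp (F G : functor C D) (s : nat_trans F G) :
    nat_trans F G :=
  NatTrans (fun A B f => _) (component := fun A => hopp (s A)).
Next Obligation. by move=> F G s A B f; rewrite compNm compmN naturality. Qed.

Program Definition nt_add (F G : functor C D) (s t : nat_trans F G) :
    nat_trans F G :=
  NatTrans (fun A B f => _) (component := fun A => hadd (s A) (t A)).
Next Obligation.
by move=> F G s t A B f; rewrite compDl compDr !naturality.
Qed.

Program Definition functor_preadditive : preadditive :=
  @Preadditive (functor_category D) nt_zero nt_opp nt_add _ _ _ _ _ _.
Next Obligation. by move=> F G s t u; apply: nat_trans_ext => A; exact: haddA. Qed.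
Next Obligation. by move=> F G s t; apply: nat_trans_ext => A; exact: haddC. Qed.
Next Obligation. by move=> F G s; apply: nat_trans_ext => A; exact: hadd0. Qed.
Next Obligation. by move=> F G s; apply: nat_trans_ext => A; exact: haddN. Qed.
Next Obligation.
by move=> F G H s t u; apply: nat_trans_ext => A; exact: compDl.
Qed.
Next Obligation.
by move=> F G H s t u; apply: nat_trans_ext => A; exact: compDr.
Qed.

End Preadditive.
End FunctorCategory.

(** * Exactness, Yoneda Ext, Frobenius pairs and cotorsion pairs

   These notions only need zero morphisms and sums of morphisms to be stated;
   they have their usual meaning when [C] is abelian. *)

Section Homological.
Variable C : preadditive.
Implicit Types A B D K M N W : C.

Definition obj_class := C -> Prop.
Implicit Types X Y w : obj_class.

Definition is_zero A := idm A = hzero.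

Definition is_mono A B (f : Hom A B) :=
  forall T (g h : Hom T A), f ∘ g = f ∘ h -> g = h.

Definition is_epi A B (f : Hom A B) :=
  forall T (g h : Hom B T), g ∘ f = h ∘ f -> g = h.

Definition isomorphism A B (f : Hom A B) :=
  exists g : Hom B A, g ∘ f = idm A /\ f ∘ g = idm B.

Definition is_kernel K A B (k : Hom K A) (f : Hom A B) :=
  f ∘ k = hzero /\
  forall T (t : Hom T A), f ∘ t = hzero -> exists! u : Hom T K, k ∘ u = t.

Definition is_cokernel A B D (q : Hom B D) (f : Hom A B) :=
  q ∘ f = hzero /\
  forall T (t : Hom B T), t ∘ f = hzero -> exists! u : Hom D T, u ∘ q = t.

Definition short_exact A B D (f : Hom A B) (g : Hom B D) :=
  is_kernel f g /\ is_cokernel g f.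

(* [f] factors as an epimorphism followed by a kernel of [g]: in an abelian
   category this says that the image of [f] is the kernel of [g]. *)
Definition exact_at A B D (f : Hom A B) (g : Hom B D) :=
  exists K (e : Hom A K) (k : Hom K B),
    [/\ f = k ∘ e, is_epi e & is_kernel k g].

Definition direct_summand A B :=
  exists A' (i : Hom A B) (p : Hom B A) (i' : Hom A' B) (p' : Hom B A'),
    [/\ p ∘ i = idm A, p' ∘ i' = idm A', p ∘ i' = hzero, p' ∘ i = hzero
      & hadd (i ∘ p) (i' ∘ p') = idm B].

(* An exact sequence ... -> E_2 -> E_1 -> E_0 -> M -> 0.  A finite exact
   sequence 0 -> E_n -> ... -> E_0 -> M -> 0 is one with [E_k] a zero object
   for all [k > n]. *)
Record exact_seq (M : C) : Type := ExactSeq {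
  term :> nat -> C;
  dif : forall k, Hom (term k.+1) (term k);
  aug : Hom (term 0%N) M;
  aug_epi : is_epi aug;
  exact0 : exact_at (dif 0) aug;
  exactS : forall k, exact_at (dif k.+1) (dif k) }.

(* $\mathcal{X}^\wedge_m$ *)
Definition resdim_le X (m : nat) : obj_class := fun M =>
  exists E : exact_seq M,
    (forall k, (k <= m)%N -> X (E k)) /\ (forall k, (m < k)%N -> is_zero (E k)).

(* A Yoneda n-extension 0 -> W -> E_{n-1} -> ... -> E_0 -> A -> 0, for n > 0,
   is a finite exact sequence 0 -> E_n -> ... -> E_0 -> A -> 0 together with
   an identification of [W] with [E_n]. *)
Record extension (n : nat) A W : Type := Extension {
  ext_seq :> exact_seq A;
  ext_bounded : forall k, (n < k)%N -> is_zero (ext_seq k);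
  ext_end : Hom W (ext_seq n);
  ext_end_iso : isomorphism ext_end }.

(* Existence of a morphism of n-extensions that is the identity on [A] and [W] *)
Definition extension_morph (n : nat) A W (E E' : extension n A W) :=
  exists f : forall k, Hom (E k) (E' k),
    [/\ forall k, f k ∘ dif E k = dif E' k ∘ f k.+1,
        aug E' ∘ f 0%N = aug E
      & f n ∘ ext_end E = ext_end E'].

Definition yoneda_equiv (n : nat) A W : extension n A W -> extension n A W -> Prop :=
  clos_refl_sym_trans _ (@extension_morph n A W).

(* For n > 0, Ext^n(A, W) is the group of classes of n-extensions modulo
   [yoneda_equiv]; it is never empty (it contains the class of
   0 -> W = W -> 0 -> ... -> 0 -> A = A -> 0, or of W -> W (+) A -> A when
   n = 1), so it is zero iff there is only one class. *)
Definition Ext_zero (n : nat) A W :=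
  forall E E' : extension n A W, yoneda_equiv E E'.

Definition right_perp1 X : obj_class := fun N => forall A, X A -> Ext_zero 1 A N.
Definition left_perp1 X : obj_class := fun N => forall A, X A -> Ext_zero 1 N A.

Definition closed_extensions X :=
  forall A B D (f : Hom A B) (g : Hom B D),
    short_exact f g -> X A -> X D -> X B.

Definition closed_epi_kernels X :=
  forall K A B (k : Hom K A) (f : Hom A B),
    X A -> X B -> is_epi f -> is_kernel k f -> X K.

Definition closed_summands X := forall A B, direct_summand A B -> X B -> X A.

Record frobenius_pair X w : Prop := FrobeniusPair {
  frob_extensions : closed_extensions X;
  frob_epi_kernels : closed_epi_kernels X;
  frob_summands : closed_summands X;
  frob_summandsw : closed_summands w;
  frob_ext : forall A W (i : nat), X A -> w W -> (0 < i)%N -> Ext_zero i A W;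
  frob_sub : forall W, w W -> X W;
  frob_cogen : forall A, X A ->
    exists W A' (f : Hom A W) (g : Hom W A'),
      [/\ short_exact f g, w W & X A'] }.

Definition cotorsion_pair X Y :=
  (forall N, right_perp1 X N <-> Y N) /\ (forall N, X N <-> left_perp1 Y N).

Definition complete_cotorsion_pair X Y :=
  cotorsion_pair X Y /\
  forall M : C,
    (exists D A (f : Hom D A) (g : Hom A M), [/\ short_exact f g, X A & Y D]) /\
    (exists D A (f : Hom M D) (g : Hom D A), [/\ short_exact f g, X A & Y D]).

End Homological.

(** * Left modules: the category, direct sums and cokernels *)

Section Modules.
Variable R : pzRingType.
Implicit Types U V W : lmodType R.

Lemma linear_ext U V (f g : {linear U -> V}) : f =1 g -> f = g.
Proof.
case: f g => [f fP] [g gP] /= fg.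
have e : f = g by apply: functional_extensionality_dep.
case: g / e gP {fg} => gP; congr GRing.Linear.Pack.
case: fP gP => [[a] [b]] [[c] [d]].
by congr GRing.Linear.Class; [congr GRing.isNmodMorphism.Axioms_|
  congr GRing.isScalable.Axioms_]; exact: Prop_irrelevance.
Qed.

Definition lin_id U : {linear U -> U} := idfun.
Definition lin_comp U V W (g : {linear V -> W}) (f : {linear U -> V}) :
  {linear U -> W} := g \o f.
Definition lin_zero U V : {linear U -> V} := \0.
Definition lin_opp U V (f : {linear U -> V}) : {linear U -> V} := \- f.
Definition lin_add U V (f g : {linear U -> V}) : {linear U -> V} := f \+ g.

Program Definition Mod_category : category :=
  @Category (lmodType R) (fun U V => {linear U -> V}) lin_id lin_comp _ _ _.
Next Obligation. by move=> U V f; exact: linear_ext. Qed.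
Next Obligation. by move=> U V f; exact: linear_ext. Qed.
Next Obligation. by move=> U V W Z h g f; exact: linear_ext. Qed.

Program Definition Mod : preadditive :=
  @Preadditive Mod_category lin_zero lin_opp lin_add _ _ _ _ _ _.
Next Obligation. by move=> U V f g h; apply: linear_ext => x; exact: addrA. Qed.
Next Obligation. by move=> U V f g; apply: linear_ext => x; exact: addrC. Qed.
Next Obligation. by move=> U V f; apply: linear_ext => x; exact: add0r. Qed.
Next Obligation. by move=> U V f; apply: linear_ext => x; exact: addNr. Qed.
Next Obligation. by move=> U V W g h f; exact: linear_ext. Qed.
Next Obligation. by move=> U V W g f h; apply: linear_ext => x; exact: raddfD. Qed.

Section DirectSum.
Variables (I : choiceType) (V : I -> lmodType R).

Record dsum : Type := DSum {
  dsum_val :> forall i, V i;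
  dsum_finite : finite_set [set i | dsum_val i != 0]%classic }.

Lemma dsum_ext (x y : dsum) : (forall i, x i = y i) -> x = y.
Proof.
case: x y => [x xP] [y yP] /= xy.
have e : x = y by apply: functional_extensionality_dep.
by case: y / e yP {xy} => yP; congr DSum; exact: Prop_irrelevance.
Qed.

HB.instance Definition _ := gen_eqMixin dsum.
HB.instance Definition _ := gen_choiceMixin dsum.

Program Definition dsum_zero := @DSum (fun i => 0) _.
Next Obligation.
by apply: (sub_finite_set _ (finite_set0 I)) => i /=; rewrite eqxx.
Qed.

Program Definition dsum_opp (x : dsum) := @DSum (fun i => - x i) _.
Next Obligation.
move=> x; apply: (sub_finite_set _ (dsum_finite x)) => i /=.
by rewrite oppr_eq0.
Qed.

Program Definition dsum_add (x y : dsum) := @DSum (fun i => x i + y i) _.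
Next Obligation.
move=> x y; pose S := ([set i | x i != 0] `|` [set i | y i != 0])%classic.
have finS : finite_set S by rewrite finite_setU; split; exact: dsum_finite.
apply: (sub_finite_set _ finS) => i /= xy; case: (eqVneq (x i) 0) => [x0|]; [right|by left].
by move: xy; rewrite x0 add0r.
Qed.

Program Definition dsum_scale (a : R) (x : dsum) := @DSum (fun i => a *: x i) _.
Next Obligation.
move=> a x; apply: (sub_finite_set _ (dsum_finite x)) => i /=.
by apply: contra_neq => ->; rewrite scaler0.
Qed.

Program Definition dsum_isZmodule :=
  @GRing.isZmodule.Build dsum dsum_zero dsum_opp dsum_add _ _ _ _.
Next Obligation. by move=> x y z; apply: dsum_ext => i; exact: addrA. Qed.
Next Obligation. by move=> x y; apply: dsum_ext => i; exact: addrC. Qed.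
Next Obligation. by move=> x; apply: dsum_ext => i; exact: add0r. Qed.
Next Obligation. by move=> x; apply: dsum_ext => i; exact: addNr. Qed.
HB.instance Definition _ := dsum_isZmodule.

Program Definition dsum_isLmodule :=
  @GRing.Zmodule_isLmodule.Build R dsum dsum_scale _ _ _ _.
Next Obligation. by move=> a b x; apply: dsum_ext => i; exact: scalerA. Qed.
Next Obligation. by move=> x; apply: dsum_ext => i; exact: scale1r. Qed.
Next Obligation. by move=> a x y; apply: dsum_ext => i; exact: scalerDr. Qed.
Next Obligation. by move=> x a b; apply: dsum_ext => i; exact: scalerDl. Qed.
HB.instance Definition _ := dsum_isLmodule.

(* The morphism $\coprod_i V_i \to W$ with components [h i] *)
Variables (W : lmodType R) (h : forall i, {linear V i -> W}).

Definition copair (x : dsum) : W := \sum_(i \in [set: I]%classic) h i (x i).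

Lemma copair_is_linear : linear copair.
Proof.
move=> a x y; rewrite /copair.
have fin : finite_set ([set i | x i != 0] `|` [set i | y i != 0])%classic.
  by rewrite finite_setU; split; exact: dsum_finite.
pose S := fset_set ([set i | x i != 0] `|` [set i | y i != 0])%classic.
have S0 i : i \notin S -> x i = 0 /\ y i = 0.
  rewrite in_fset_set// notin_setE /= => /not_orP[/negP xi /negP yi].
  by rewrite !negbK in xi yi; split; exact/eqP.
have sumE (z : dsum) : (forall i, i \notin S -> z i = 0) ->
    \sum_(i \in [set: I]%classic) h i (z i) = \sum_(i <- S) h i (z i).
  by move=> z0; apply: fsbigTE => i /z0 ->; exact: raddf0.
have -> := sumE x (fun i iS => (S0 i iS).1).
have -> := sumE y (fun i iS => (S0 i iS).2).
rewrite (sumE (a *: x + y)) => [|i /S0[xi yi]]; last first.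
  by rewrite /= xi yi scaler0 addr0.
rewrite scaler_sumr -big_split /=; apply: eq_bigr => i _.
exact: linearP.
Qed.

HB.instance Definition _ :=
  GRing.isLinear.Build R dsum W *:%R copair copair_is_linear.

End DirectSum.

Section Cokernel.
Variables (U V : lmodType R) (f : {linear U -> V}).

Definition in_image : {pred V} := fun y => `[< exists x, f x = y >].

Lemma in_image_zmod_closed : zmod_closed in_image.
Proof.
split; first by apply/asboolP; exists 0; exact: raddf0.
move=> y z /asboolP[u <-] /asboolP[v <-].
by apply/asboolP; exists (u - v); exact: raddfB.
Qed.

HB.instance Definition _ := GRing.isZmodClosed.Build V in_image in_image_zmod_closed.

Definition coker : Type := Quotient.quot in_image.
HB.instance Definition _ := GRing.Zmodule.on coker.

Definition coker_pi (y : V) : coker := \pi_(Quotient.quot in_image) y.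

Lemma coker_piP y z : coker_pi y = coker_pi z <-> exists x, f x = y - z.
Proof.
rewrite /coker_pi; split=> [/eqP|yz].
  by rewrite -Quotient.idealrBE => /asboolP.
by apply/eqP; rewrite -Quotient.idealrBE; apply/asboolP.
Qed.

Lemma coker_piD y z : coker_pi (y + z) = coker_pi y + coker_pi z.
Proof. exact: Quotient.pi_add. Qed.

Lemma coker_repr (q : coker) : coker_pi (repr (q : Quotient.quot in_image)) = q.
Proof. exact: reprK. Qed.

Definition coker_scale (a : R) (q : coker) : coker :=
  coker_pi (a *: repr (q : Quotient.quot in_image)).

Lemma coker_scale_pi a y : coker_scale a (coker_pi y) = coker_pi (a *: y).
Proof.
apply/coker_piP; rewrite -scalerBr.
have /coker_piP[x <-] := coker_repr (coker_pi y).
by exists (a *: x); exact: linearZ.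
Qed.

Program Definition coker_isLmodule :=
  @GRing.Zmodule_isLmodule.Build R coker coker_scale _ _ _ _.
Next Obligation.
by move=> a b q; rewrite -(coker_repr q) !coker_scale_pi scalerA.
Qed.
Next Obligation.
by move=> q; rewrite -(coker_repr q) !coker_scale_pi scale1r.
Qed.
Next Obligation.
move=> a q r; rewrite -(coker_repr q) -(coker_repr r).
by rewrite -coker_piD !coker_scale_pi scalerDr coker_piD.
Qed.
Next Obligation.
move=> q a b; rewrite -(coker_repr q) !coker_scale_pi.
by rewrite scalerDl coker_piD.
Qed.
HB.instance Definition _ := coker_isLmodule.

End Cokernel.

End Modules.

(** * Quivers and their representations *)

(* The set of arrows is given by its fibres over pairs (source, target);
   the arrows with target [i] form the type [{j & arrow j i}].  Requiring
   [choiceType] is no restriction on sets of vertices and arrows, classically. *)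
Record quiver : Type := Quiver {
  vertex :> choiceType;
  arrow : vertex -> vertex -> choiceType }.

Arguments arrow {q} i j : rename.

Definition left_rooted (Q : quiver) :=
  ~ exists v : nat -> Q, forall n, inhabited (arrow (v n.+1) (v n)).

Section Representations.
Variable Q : quiver.

Inductive qpath (i : Q) : Q -> Type :=
| qnil : qpath i i
| qcons j k (p : qpath i j) (a : arrow j k) : qpath i k.

Fixpoint qcat (i j k : Q) (q : qpath j k) (p : qpath i j) : qpath i k :=
  match q with
  | qnil => p
  | qcons _ _ q' a => qcons (qcat q' p) a
  end.

Program Definition path_category : category :=
  @Category Q qpath qnil (fun i j k q p => qcat q p) _ _ _.
Next Obligation. by []. Qed.
Next Obligation. by move=> i j; elim=> //= k l p -> a. Qed.
Next Obligation.
by move=> i j k l r q p; elim: r => //= k' l' r -> a.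
Qed.

Definition arrow_path (i j : Q) (a : arrow i j) : @Hom path_category i j :=
  qcons (qnil i) a.

Variable R : pzRingType.

Definition Rep : preadditive := functor_preadditive path_category (Mod R).

Definition phi (F : Rep) (i : Q) :
    @Hom (Mod R) (@dsum R {j : Q & arrow j i} (fun a => fobj F (tag a)))
                 (fobj F i) :=
  @copair R {j : Q & arrow j i} (fun a => fobj F (tag a)) (fobj F i)
    (fun a => fmap F (arrow_path (tagged a))).

Definition coker_phi (F : Rep) (i : Q) : lmodType R := coker (phi F i).

Definition Rep_class (X : obj_class (Mod R)) : obj_class Rep :=
  fun F => forall i : Q, X (fobj F i).

Definition Phi (X : obj_class (Mod R)) : obj_class Rep :=
  fun F => forall i : Q, is_mono (phi F i) /\ X (coker_phi F i).

End Representations.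

(* Main.v *)
(* The class W = w^_m contains the projectives, because it is the left half of a
   cotorsion pair, and a projective module of finite w-resolution dimension is a
   summand of a module in w.  So X is a resolving class containing the
   projectives, and by the horseshoe lemma the class Y = X^_m is resolving too.
   The Auslander-Buchweitz approximations M -> L -> D of M in Y (L in W, D in X)
   and dimension shifting give Ext^1(Y, W /\ W^perp) = 0.

   As Q is left rooted, morphisms and representations can be built vertex by
   vertex.  A lift out of A along p : E -> B with kernel V extends from the image
   of phi^A_i to A(i), the obstruction being in Ext^1(C_i(A), V(i)).  Likewise an
   embedding of A in Phi(Y) into an object of Phi(W) /\ Rep(Q, W^perp) is extended
   at i by a pushout followed by an approximation and a special preenvelope.  The
   closure properties of Phi(Y) come from the snake lemma for the phi_i.  Finally
   all Ext^n(A, V) vanish because Phi(Y) has enough projective objects and is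
   closed under syzygies. *)
From HB Require Import structures.
From Stdlib Require Import Relation_Operators.
From mathcomp Require Import all_boot all_algebra.
From mathcomp Require Import boolp classical_sets functions cardinality fsbigop.
From mathcomp Require Import finmap.
Require Import Defs.

Set Implicit Arguments.
Unset Strict Implicit.
Unset Printing Implicit Defensive.

Import GRing.Theory.
Local Open Scope ring_scope.

(** * Modules and short exact sequences *)

Section LinearAlgebra.
Variable R : pzRingType.
Implicit Types U V W A B C D E K P S : lmodType R.

(** [X] and [w] are not assumed closed under coproducts, whereas the module coming into a vertex is
    a possibly infinite coproduct. The class W is closed under coproducts because it is a left
    Ext-orthogonal class, and this shapes the embedding of A: besides the cokernels C_i(V), the
    modules V(i) themselves are kept in W, so that the sum S of the V(j) over the arrows into i is
    again in W. The pushout U of A(i) and S has U / S = C_i(A), which is in Y but need not be in W.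
    Replacing C_i(A) by an approximation L in W meets an obstruction in Ext^2(L / C_i(A), S); it
    vanishes because L / C_i(A) is in X and S is in W. The quotient of the embedding must lie in
    Phi(Y) again: its phi_i are injective because A(i) and S meet inside V(i) only in the image of
    the sum of the A(j). Ext is never computed as a group. In degree one its vanishing is a lifting
    property, and in every positive degree Yoneda Ext vanishes as soon as a single extension maps to
    all the others. *)

Lemma linear_of_rel U V (r : U -> V -> Prop) :
  (forall x, exists y, r x y) ->
  (forall x x' y y', r x y -> r x' y' -> r (x + x') (y + y')) ->
  (forall a x y, r x y -> r (a *: x) (a *: y)) ->
  (forall y, r 0 y -> y = 0) ->
  exists f : {linear U -> V}, forall x, r x (f x).
Proof.
move=> tot rD rZ r0; have [f fP] := choice tot.
(* Two values at one argument differ by a value at 0. So the relation is a graph, and the chosen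
   function inherits linearity from it. *)
have runiq x y y' : r x y -> r x y' -> y = y'.
  move=> xy /(rZ (-1)) xy'; apply/eqP; rewrite -subr_eq0; apply/eqP/r0.
  by rewrite -(subrr x) -[- x]scaleN1r -[- y']scaleN1r; exact: rD.
have f_lin : linear f.
  by move=> a x y; apply: runiq (fP _) _; apply: rD => //; exact: rZ.
pose Lf := GRing.isLinear.Build R U V *:%R f f_lin.
pose f' : {linear U -> V} := HB.pack f Lf.
by exists f'.
Qed.

Lemma inj_linear U V (f : {linear U -> V}) :
  (forall x, f x = 0 -> x = 0) -> injective f.
Proof.
move=> f0 x y fxy; apply/eqP; rewrite -subr_eq0; apply/eqP/f0.
by rewrite linearB fxy subrr.
Qed.

Definition onto (U V : Type) (f : U -> V) := forall y, exists x, f x = y.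

Record ses A B C (f : {linear A -> B}) (g : {linear B -> C}) : Prop := Ses {
  ses_inj : injective f;
  ses_surj : onto g;
  ses_ker : forall y, g y = 0 -> exists x, f x = y;
  ses_comp : forall x, g (f x) = 0 }.

Lemma factor_inj U V W (k : {linear U -> V}) (f : {linear W -> V}) :
  injective k -> (forall x, exists y, k y = f x) ->
  exists h : {linear W -> U}, forall x, k (h x) = f x.
Proof.
move=> kI kf; apply: (linear_of_rel (r := fun x y => k y = f x)) => //.
- by move=> x x' y y' e e'; rewrite !linearD e e'.
- by move=> a x y e; rewrite !linearZ e.
- by move=> y; rewrite linear0 => ky; apply: kI; rewrite ky linear0.
Qed.

Lemma factor_surj U V W (q : {linear U -> V}) (f : {linear U -> W}) :
  onto q -> (forall x, q x = 0 -> f x = 0) ->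
  exists h : {linear V -> W}, forall x, h (q x) = f x.
Proof.
move=> qS qf.
have [|||y [x [qx <-]]|h hP] :=
    linear_of_rel (r := fun y z => exists x, q x = y /\ f x = z).
- by move=> y; have [x <-] := qS y; exists (f x), x.
- move=> _ _ _ _ [x [<- <-]] [x' [<- <-]]; exists (x + x').
  by rewrite !linearD.
- by move=> a _ _ [x [<- <-]]; exists (a *: x); rewrite !linearZ.
- exact: qf.
exists h => x; have [x' [qx <-]] := hP (q x).
apply/eqP; rewrite -subr_eq0 -linearB; apply/eqP/qf.
by rewrite linearB qx subrr.
Qed.

Section Kernel.
Variables (U V : lmodType R) (f : {linear U -> V}).
Definition in_kernel : {pred U} := fun x => f x == 0.
Lemma in_kernel_submod_closed : submod_closed in_kernel.
Proof.
split; first by rewrite unfold_in linear0.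
by move=> a x y; rewrite !unfold_in linearP => /eqP -> /eqP ->; rewrite scaler0 addr0.
Qed.
HB.instance Definition _ :=
  GRing.isSubmodClosed.Build R U in_kernel in_kernel_submod_closed.
Record kernel := Kernel { kernel_val : U; _ : kernel_val \in in_kernel }.
HB.instance Definition _ := [isSub for kernel_val].
HB.instance Definition _ := [Choice of kernel by <:].
HB.instance Definition _ := [SubChoice_isSubLmodule of kernel by <:].
Definition kernel_incl : {linear kernel -> U} := val : {linear _ -> _}.
Lemma kernel_incl_inj : injective kernel_incl.
Proof. exact: val_inj. Qed.
Lemma kernel_inclP x : f x = 0 <-> exists y, kernel_incl y = x.
Proof.
split=> [/eqP fx|[[y /eqP fy] <-] //]; by exists (Kernel (fx : x \in in_kernel)).
Qed.
End Kernel.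

Lemma ses_kernel U V (f : {linear U -> V}) : onto f -> ses (kernel_incl f) f.
Proof.
move=> fS; split=> //; first by move=> y /kernel_inclP.
by move=> x; apply/kernel_inclP; exists x.
Qed.

Lemma has_kernel U V (f : {linear U -> V}) : onto f ->
  exists (K : lmodType R) (k : {linear K -> U}), ses k f.
Proof. by move=> fS; exists _, (kernel_incl f); exact: ses_kernel. Qed.

Section Cokernel.
Variables (U V : lmodType R) (f : {linear U -> V}).

Lemma coker_pi_is_linear : linear (coker_pi f : V -> coker f).
Proof. by move=> a x y; rewrite coker_piD -coker_scale_pi. Qed.
HB.instance Definition _ :=
  GRing.isLinear.Build R V (coker f) *:%R (coker_pi f) coker_pi_is_linear.
Definition coker_proj : {linear V -> coker f} := coker_pi f.

Lemma coker_proj_surj : onto coker_proj.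
Proof. by move=> q; exists (repr (q : Quotient.quot (in_image f))); exact: coker_repr. Qed.

Lemma coker_projP y : coker_proj y = 0 <-> exists x, f x = y.
Proof.
rewrite -(linear0 coker_proj) coker_piP; by split=> -[x fx]; exists x; rewrite fx subr0.
Qed.
End Cokernel.

Lemma ses_coker U V (f : {linear U -> V}) : injective f -> ses f (coker_proj f).
Proof.
move=> fI; split=> //; first exact: coker_proj_surj.
  by move=> y /coker_projP.
by move=> x; apply/coker_projP; exists x.
Qed.

Definition pair_map U V W (f : {linear U -> W}) (g : {linear V -> W}) :
  U * V -> W := fun x => f x.1 + g x.2.
Lemma pair_map_is_linear U V W (f : {linear U -> W}) (g : {linear V -> W}) :
  linear (pair_map f g).
Proof. by move=> a x y; rewrite /pair_map /= !linearP scalerDr addrACA. Qed.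
HB.instance Definition _ U V W f g :=
  GRing.isLinear.Build R (U * V)%type W *:%R (@pair_map U V W f g)
    (pair_map_is_linear f g).

Definition into_pair U V W (f : {linear W -> U}) (g : {linear W -> V}) :
  W -> U * V := fun x => (f x, g x).
Lemma into_pair_is_linear U V W (f : {linear W -> U}) (g : {linear W -> V}) :
  linear (into_pair f g).
Proof. by move=> a x y; rewrite /into_pair !linearP. Qed.
HB.instance Definition _ U V W f g :=
  GRing.isLinear.Build R W (U * V)%type *:%R (@into_pair U V W f g)
    (into_pair_is_linear f g).

Definition inl_lin U V : {linear U -> (U * V)%type} := into_pair idfun \0.
Definition inr_lin U V : {linear V -> (U * V)%type} := into_pair \0 idfun.
Definition fst_lin U V : {linear (U * V)%type -> U} := fst : {linear _ -> _}.
Definition snd_lin U V : {linear (U * V)%type -> V} := snd : {linear _ -> _}.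

Lemma ses_pair U V : ses (@inl_lin U V) (@snd_lin U V).
Proof.
split=> //; first by move=> x y [].
  by move=> y; exists (0, y).
by move=> [x y] /= ->; exists x.
Qed.

Lemma inl_inr U V (x : U) (y : V) : inl_lin U V x + inr_lin U V y = (x, y).
Proof. by congr pair; rewrite /= ?addr0 ?add0r. Qed.

(** Elementwise form of the universal property: E contains nothing beyond the two images, and
    nothing is identified beyond K. Injectivity and exactness can be read off from these clauses
    directly. *)
Lemma pushout K A B (f : {linear K -> A}) (g : {linear K -> B}) :
  exists E (a : {linear A -> E}) (b : {linear B -> E}),
    (forall e, exists x y, e = a x + b y) /\
    (forall x y, a x = b y <-> exists k, f k = x /\ g k = y).
Proof.
pose h : {linear K -> (A * B)%type} := into_pair f (\- g).
exists (coker h), (coker_proj h \o @inl_lin A B), (coker_proj h \o @inr_lin A B).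
split=> [e|x y].
  have [[x y] <-] := coker_proj_surj e; exists x, y.
  by rewrite /= -linearD inl_inr.
have hE : coker_proj h (inl_lin A B x) - coker_proj h (inr_lin A B y) =
    coker_proj h (x, - y) by rewrite -linearB -linearN -[in RHS]inl_inr linearN.
split=> [/eqP|[k [fk gk]]]; [rewrite -subr_eq0 /= hE|apply/eqP; rewrite -subr_eq0 /= hE].
  move=> /eqP/coker_projP[k] [fk /oppr_inj gk]; by exists k.
by apply/eqP/coker_projP; exists k; rewrite -fk -gk.
Qed.

Definition iso U V (f : {linear U -> V}) := injective f /\ onto f.

(** Serves to carry a property from a cokernel known only through an exact sequence to the concrete
    quotient [coker] that occurs in [Phi]. *)
Lemma iso_of_ker U V W (f : {linear U -> V}) (g : {linear U -> W}) :
  onto f -> onto g -> (forall x, f x = 0 <-> g x = 0) ->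
  exists h : {linear V -> W}, iso h.
Proof.
move=> fS gS fg; have [x /fg //|h hP] := factor_surj fS (f := g).
exists h; split; last first.
  by move=> z; have [x <-] := gS z; exists (f x).
by apply: inj_linear => y; have [x <-] := fS y; rewrite hP => /fg.
Qed.

End LinearAlgebra.

(** * Direct sums of modules and of linear maps *)

Section DirectSums.
Variables (R : pzRingType) (I : choiceType).
Implicit Types (V : I -> lmodType R) (W : lmodType R).

Lemma single_finite V i (x : V i) :
  finite_set [set j | dfwith (fun j => 0 : V j) x j != 0]%classic.
Proof.
apply: (sub_finite_set _ (finite_set1 i)) => j /=.
by case: (eqVneq j i) => // ij; rewrite dfwith_out ?eqxx // eq_sym.
Qed.

Definition dsum_single V i (x : V i) : dsum V := DSum (single_finite x).

Lemma dsum_single_in V i (x : V i) : dsum_single x i = x.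
Proof. exact: dfwith_in. Qed.

Lemma dsum_single_out V i j (x : V i) : i != j -> dsum_single x j = 0.
Proof. exact: dfwith_out. Qed.

Lemma dsum_single_is_linear V i : linear (@dsum_single V i).
Proof.
move=> a x y; apply: dsum_ext => j.
rewrite -[RHS]/(a *: dsum_single x j + dsum_single y j).
have [<-|ij] := eqVneq i j; first by rewrite !dsum_single_in.
by rewrite !dsum_single_out // scaler0 addr0.
Qed.
HB.instance Definition _ V i :=
  GRing.isLinear.Build R (V i) (dsum V) *:%R (@dsum_single V i)
    (@dsum_single_is_linear V i).

Definition dsum_inj V i : {linear V i -> dsum V} := @dsum_single V i.

Definition dsum_at V i (x : dsum V) : V i := x i.
Lemma dsum_at_is_linear V i : linear (@dsum_at V i).
Proof. by []. Qed.
HB.instance Definition _ V i :=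
  GRing.isLinear.Build R (dsum V) (V i) *:%R (@dsum_at V i)
    (@dsum_at_is_linear V i).

Lemma dsum_sum V (x : dsum V) :
  x = \sum_(i <- fset_set [set i | x i != 0]%classic) dsum_inj V i (x i).
Proof.
apply: dsum_ext => j; rewrite -[RHS]/(dsum_at j _) raddf_sum.
set S := fset_set _.
have inS i : (i \in S) = (x i != 0).
  rewrite in_fset_set; last exact: dsum_finite.
  by apply/idP/idP => [/set_mem //|xi]; apply/mem_set.
have outj i : i != j -> dsum_at j (dsum_inj V i (x i)) = 0 by exact: dsum_single_out.
have [xj0|xj0] := eqVneq (x j) 0.
  rewrite xj0 big1 // => i _; have [ij|/outj //] := eqVneq i j.
  by case: j / ij xj0 {outj} => xi0; rewrite -[RHS]xi0; exact: dsum_single_in.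
rewrite (bigD1_seq j) ?inS ?fset_uniq //= big1 => [|i /outj //].
by rewrite addr0; exact/esym/dsum_single_in.
Qed.

Lemma dsum_hom_ext V W (f g : {linear dsum V -> W}) :
  (forall i x, f (dsum_inj V i x) = g (dsum_inj V i x)) -> f =1 g.
Proof.
move=> fg x; rewrite (dsum_sum x) !raddf_sum.
by apply: eq_bigr => i _; exact: fg.
Qed.

Lemma copair_inj V W (h : forall i, {linear V i -> W}) i x :
  copair h (dsum_inj V i x) = h i x.
Proof.
rewrite /copair (fsbigTE [fset i]%fset) => [|j].
  by rewrite big_seq_fset1 dsum_single_in.
rewrite inE eq_sym => ij; by rewrite dsum_single_out ?raddf0.
Qed.

Section Map.
Variables (V V' : I -> lmodType R) (f : forall i, {linear V i -> V' i}).

Lemma dsum_map_finite (x : dsum V) :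
  finite_set [set i | f i (x i) != 0]%classic.
Proof.
apply: (sub_finite_set _ (dsum_finite x)) => i /=.
by apply: contra_neq => ->; rewrite linear0.
Qed.
Definition dsum_map_fun x := DSum (dsum_map_finite x).
Lemma dsum_map_is_linear : linear dsum_map_fun.
Proof. by move=> a x y; apply: dsum_ext => i; exact: linearP. Qed.
HB.instance Definition _ :=
  GRing.isLinear.Build R (dsum V) (dsum V') *:%R dsum_map_fun dsum_map_is_linear.
Definition dsum_map : {linear dsum V -> dsum V'} := dsum_map_fun.

Lemma dsum_map_single i x : dsum_map (dsum_inj V i x) = dsum_inj V' i (f i x).
Proof.
apply: dsum_ext => j.
rewrite -[LHS]/(f j (dsum_single x j)) -[RHS]/(dsum_single (f i x) j).
have [ij|ij] := eqVneq i j; first by case: j / ij; rewrite !dsum_single_in.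
by rewrite !dsum_single_out // linear0.
Qed.

Lemma dsum_map_inj : (forall i, injective (f i)) -> injective dsum_map.
Proof.
move=> fI x y exy; apply: dsum_ext => i; apply: (fI i).
exact: (congr1 (fun z : dsum V' => z i) exy).
Qed.

Lemma dsum_map_lift (y : dsum V') :
  (forall i, exists x, f i x = y i) -> exists x, dsum_map x = y.
Proof.
(* The preimage of 0 has to be 0, otherwise the chosen family might have infinite support. *)
move=> fy; have fy' i : exists x, f i x = y i /\ (y i = 0 -> x = 0).
  have [y0|y0] := eqVneq (y i) 0; first by exists 0; rewrite y0 linear0.
  by have [x fx] := fy i; exists x; split=> // yi; rewrite yi eqxx in y0.
pose x i := sval (cid (fy' i)).
have xP i : f i (x i) = y i /\ (y i = 0 -> x i = 0) by exact: svalP (cid (fy' i)).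
have xfin : finite_set [set i | x i != 0]%classic.
  apply: (sub_finite_set _ (dsum_finite y)) => i /=.
  by apply: contra_neq; exact: (xP i).2.
by exists (DSum xfin); apply: dsum_ext => i; exact: (xP i).1.
Qed.

End Map.

Lemma dsum_map_ses V V' V'' (f : forall i, {linear V i -> V' i})
    (g : forall i, {linear V' i -> V'' i}) :
  (forall i, ses (f i) (g i)) -> ses (dsum_map f) (dsum_map g).
Proof.
move=> fg; split.
- by apply: dsum_map_inj => i; exact: ses_inj (fg i).
- by move=> y; apply: dsum_map_lift => i; exact: (ses_surj (fg i)).
- move=> y gy; apply: dsum_map_lift => i; apply: (ses_ker (fg i)).
  exact: (congr1 (fun z : dsum V'' => z i) gy).
- by move=> x; apply: dsum_ext => i; exact: (ses_comp (fg i)).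
Qed.

End DirectSums.

(** * Free and projective modules *)

Section Free.
Variable R : pzRingType.
Implicit Types A B C K M P : lmodType R.

Definition projective P :=
  forall B C (p : {linear B -> C}) (g : {linear P -> C}),
    onto p -> exists h : {linear P -> B}, forall x, p (h x) = g x.

Definition scalev_fun M (x : M) (a : R^o) : M := (a : R) *: x.
Lemma scalev_is_linear M (x : M) : linear (scalev_fun x).
Proof. by move=> a b c; rewrite /scalev_fun scalerDl scalerA. Qed.
HB.instance Definition _ M x :=
  GRing.isLinear.Build R R^o M *:%R (@scalev_fun M x) (@scalev_is_linear M x).

Definition scalev M (x : M) : {linear R^o -> M} := scalev_fun x.

Definition free_mod (S : choiceType) : lmodType R := dsum (fun _ : S => R^o).

Lemma free_projective (S : choiceType) : projective (free_mod S).
Proof.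
move=> B C p g pS.
have [h hP] := choice (fun s : S => pS (g (dsum_inj (fun _ : S => R^o) s 1))).
exists (copair (fun s => scalev (h s))).
apply: (dsum_hom_ext (f := p \o copair (fun s => scalev (h s))) (g := g)) => s a.
rewrite [LHS]/= copair_inj [scalev _ _]/= linearZ hP -linearZ.
apply: (congr1 g); rewrite -linearZ; apply: (congr1 (dsum_inj _ s)).
exact: (mulr1 (a : R)).
Qed.

Definition free_cover M : {linear free_mod M -> M} :=
  copair (fun x : M => scalev x).

Lemma free_cover_surj M : onto (@free_cover M).
Proof.
move=> x; exists (dsum_inj (fun _ : M => R^o) x 1).
by rewrite /free_cover /= copair_inj; exact: scale1r.
Qed.

Lemma projective_pair P P' : projective P -> projective P' -> projective (P * P')%type.
Proof.
move=> pP pP' B C p g pS.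
have [h hP] := pP _ _ p (g \o @inl_lin R P P') pS.
have [h' hP'] := pP' _ _ p (g \o @inr_lin R P P') pS.
exists (pair_map h h') => -[x y]; rewrite /pair_map /= linearD hP hP' /= -linearD.
by rewrite inl_inr.
Qed.

End Free.

(** * Vanishing of Ext^1 and resolution dimension of modules *)

Section ExtVanishing.
Variable R : pzRingType.
Implicit Types A B C D E K L M P S V W : lmodType R.

(* $\mathrm{Ext}^1(A, V) = 0$, in the form of a lifting property *)
Definition ext1_zero A V :=
  forall E B (k : {linear V -> E}) (p : {linear E -> B}), ses k p ->
  forall g : {linear A -> B}, exists h : {linear A -> E}, forall x, p (h x) = g x.

Definition splits A V :=
  forall E (k : {linear V -> E}) (p : {linear E -> A}), ses k p ->
  exists s : {linear A -> E}, forall x, p (s x) = x.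

Lemma ext1_splits A V : ext1_zero A V -> splits A V.
Proof. by move=> AV E k p kp; have [s] := AV _ _ _ _ kp idfun; exists s. Qed.

(** The pushout of the sequence along f is an extension of A by V. A section s of it makes b - s q a
    map from P into the image of V, and on K this map is f because q vanishes there. *)
Lemma splits_extend A V K P (i : {linear K -> P}) (q : {linear P -> A})
    (f : {linear K -> V}) :
  splits A V -> ses i q -> exists g : {linear P -> V}, forall x, g (i x) = f x.
Proof.
move=> AV iq; have [E [a [b [ab abP]]]] := pushout f i.
have ker0 x y : a x + b y = 0 -> q y = 0.
  move=> /eqP; rewrite addr_eq0 -linearN => /eqP/abP[k [_ ik]].
  by rewrite -[y]opprK -ik linearN (ses_comp iq) oppr0.
have abS : onto (pair_map a b).
  by move=> e; have [x [y ->]] := ab e; exists (x, y).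
have [|p pP] := factor_surj (f := q \o @snd_lin R V P) abS.
  by move=> [x y] /ker0.
have pE x y : p (a x + b y) = q y by exact: (pP (x, y)).
have pa x : p (a x) = 0 by have := pE x 0; rewrite !linear0 addr0.
have pb y : p (b y) = q y by have := pE 0 y; rewrite linear0 add0r.
have ap : ses a p.
  split=> //.
  - apply: inj_linear => x; rewrite -(linear0 b) => /abP[k [<-]].
    by rewrite -(linear0 i) => /(ses_inj iq) ->; rewrite linear0.
  - by move=> y; have [x <-] := ses_surj iq y; exists (b x).
  - move=> e; have [x [y ->]] := ab e; rewrite pE => /(ses_ker iq)[k <-].
    by exists (x + f k); rewrite linearD; congr (_ + _); apply/abP; exists k.
have [s sP] := AV _ _ _ ap.
have [y|g gP] := factor_inj (f := b \- (s \o q)) (ses_inj ap).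
  by apply: (ses_ker ap); rewrite linearB /= sP pb subrr.
exists g => x; apply: (ses_inj ap); rewrite gP /= (ses_comp iq) linear0 subr0.
by apply/esym/abP; exists x.
Qed.

(* Writing [A] as the quotient of [S * P] by the syzygy [K] of [C], a lift along
   [p] on [A] amounts to compatible lifts on [S] and [P]; these differ on [K]
   by a map to [V], which extends to [P]. *)
Lemma splits_extend_lift S A C V E B (f : {linear S -> A}) (c : {linear A -> C})
    (k : {linear V -> E}) (p : {linear E -> B}) (g : {linear A -> B})
    (s : {linear S -> E}) :
  splits C V -> ses f c -> ses k p -> (forall x, p (s x) = g (f x)) ->
  exists t : {linear A -> E}, (forall x, p (t x) = g x) /\ (forall x, t (f x) = s x).
Proof.
move=> CV fc kp psg; pose P := free_mod R C; pose q := @free_cover R C.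
have Pproj : projective P := @free_projective R C.
have qS : onto q := @free_cover_surj R C.
have [K [i kq]] := has_kernel qS.
have [q' q'P] := Pproj _ _ _ q (ses_surj fc).
have [h hP] := Pproj _ _ _ (g \o q') (ses_surj kp).
have [x|j jP] := factor_inj (f := q' \o i) (ses_inj fc).
  by apply: (ses_ker fc); rewrite /= q'P; exact: ses_comp kq x.
have [x|d dP] := factor_inj (f := (s \o j) \- (h \o i)) (ses_inj kp).
  by apply: (ses_ker kp); rewrite linearB /= psg jP hP /= subrr.
have [r rP] := splits_extend d CV kq.
have t0 x y : f x + q' y = 0 -> s x + (h y + k (r y)) = 0.
  move=> fq; have : q y = 0.
    by rewrite -q'P -(linear0 c) -fq linearD (ses_comp fc) add0r.
  move=> /(ses_ker kq)[z zy]; rewrite -zy rP dP /= [h _ + _]addrC subrK.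
  rewrite -linearD; have -> : x + j z = 0; last by rewrite linear0.
  by apply: (ses_inj fc); rewrite linearD jP /= zy fq linear0.
have fqS : onto (pair_map f q').
  move=> a; have [y yP] := qS (c a).
  have [|x xP] := ses_ker fc (y := a - q' y).
    by rewrite linearB q'P yP subrr.
  by exists (x, y); rewrite /pair_map /= xP subrK.
have [|t tP] := factor_surj (f := pair_map s (h \+ (k \o r))) fqS.
  by move=> [x y] /t0.
have tE x y : t (f x + q' y) = s x + (h y + k (r y)) by exact: (tP (x, y)).
exists t; split=> x; last first.
  by have := tE x 0; rewrite !linear0 !addr0.
have [[y z] <-] := fqS x; rewrite tP /pair_map /= !linearD psg hP.
by rewrite (ses_comp kp) addr0.
Qed.

Lemma splits_ext1 A V : splits A V -> ext1_zero A V.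
Proof.
move=> AV E B k p kp g.
(* An absolute lift is one that extends the zero map from the zero submodule, here presented as the
   kernel of the identity of A. *)
have z0 : onto (idfun : {linear A -> A}) by move=> x; exists x.
have zz := ses_kernel z0.
have [x|t [tP _]] := splits_extend_lift (g := g) (s := \0) AV zz kp; last by exists t.
by rewrite linear0 [kernel_incl _ x](ses_comp zz x : _ = 0) linear0.
Qed.

Lemma ext1_extend A V K P (i : {linear K -> P}) (q : {linear P -> A})
    (f : {linear K -> V}) :
  ext1_zero A V -> ses i q -> exists g : {linear P -> V}, forall x, g (i x) = f x.
Proof. by move=> /ext1_splits AV; exact: splits_extend. Qed.

Lemma ext1_extend_lift S A C V E B (f : {linear S -> A}) (c : {linear A -> C})
    (k : {linear V -> E}) (p : {linear E -> B}) (g : {linear A -> B})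
    (s : {linear S -> E}) :
  ext1_zero C V -> ses f c -> ses k p -> (forall x, p (s x) = g (f x)) ->
  exists t : {linear A -> E}, (forall x, p (t x) = g x) /\ (forall x, t (f x) = s x).
Proof. by move=> /ext1_splits CV; exact: splits_extend_lift. Qed.

(** For projective P, Ext^1(A, V) is the cokernel of Hom(P, V) -> Hom(K, V). Concretely, a lift h of
    q to E restricts to some f on K, and an extension g of f corrects h into a map that vanishes on
    K and so descends to a section. *)
Lemma ext1_of_cover A V K P (i : {linear K -> P}) (q : {linear P -> A}) :
  projective P -> ses i q ->
  (forall f : {linear K -> V}, exists g : {linear P -> V}, forall x, g (i x) = f x) ->
  ext1_zero A V.
Proof.
move=> Pproj iq ext; apply: splits_ext1 => E k p kp.
have [h hP] := Pproj _ _ _ q (ses_surj kp).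
have [x|f fP] := factor_inj (f := h \o i) (ses_inj kp).
  by apply: (ses_ker kp); rewrite /= hP (ses_comp iq).
have [g gP] := ext f.
have [|s sP] := factor_surj (f := h \- (k \o g)) (ses_surj iq).
  by move=> _ /(ses_ker iq)[x <-]; rewrite /= gP fP /= subrr.
exists s => x; have [y <-] := ses_surj iq x.
by rewrite sP /= linearB hP (ses_comp kp) subr0.
Qed.

Lemma projective_ext1 P V : projective P -> ext1_zero P V.
Proof. by move=> Pproj E B k p kp g; apply: Pproj; exact: ses_surj kp. Qed.

Lemma ext1_extension S A C V (f : {linear S -> A}) (c : {linear A -> C}) :
  ses f c -> ext1_zero S V -> ext1_zero C V -> ext1_zero A V.
Proof.
move=> fc SV CV E B k p kp g; have [s sP] := SV _ _ _ _ kp (g \o f).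
by have [t [tP _]] := ext1_extend_lift CV fc kp sP; exists t.
Qed.

Lemma ext1_dsum (I : choiceType) (A : I -> lmodType R) V :
  (forall i, ext1_zero (A i) V) -> ext1_zero (dsum A) V.
Proof.
move=> AV E B k p kp g.
pose h i := sval (cid (AV i _ _ _ _ kp (g \o dsum_inj A i))).
have hP i x : p (h i x) = g (dsum_inj A i x).
  exact: (svalP (cid (AV i _ _ _ _ kp (g \o dsum_inj A i)))).
exists (copair h); apply: (dsum_hom_ext (f := p \o copair h)) => i x.
by rewrite [LHS]/= copair_inj.
Qed.

Lemma ext1_retract_l A B V (i : {linear A -> B}) (r : {linear B -> A}) :
  (forall x, r (i x) = x) -> ext1_zero B V -> ext1_zero A V.
Proof.
move=> ri BV E D k p kp g; have [h hP] := BV _ _ _ _ kp (g \o r).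
by exists (h \o i) => x; rewrite /= hP /= ri.
Qed.

Lemma ext1_retract_r A V W (i : {linear V -> W}) (r : {linear W -> V}) :
  (forall x, r (i x) = x) -> ext1_zero A W -> ext1_zero A V.
Proof.
move=> ri AW; have qS := @free_cover_surj R A.
apply: (ext1_of_cover (@free_projective R A) (ses_kernel qS)) => f.
have [g gP] := ext1_extend (i \o f) AW (ses_kernel qS).
by exists (r \o g) => x; rewrite [LHS]/= gP /= ri.
Qed.

(** The piece Ext^1(A, W) -> Ext^1(A, V) -> Ext^2(A, L) of the long exact sequence, with the last
    term written as Ext^1(K, L). *)
Lemma ext1_shift A V W K L P (i : {linear K -> P}) (q : {linear P -> A})
    (j : {linear L -> W}) (r : {linear W -> V}) :
  projective P -> ses i q -> ses j r -> ext1_zero K L -> ext1_zero A W ->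
  ext1_zero A V.
Proof.
move=> Pproj iq jr KL AW; apply: (ext1_of_cover Pproj iq) => f.
have [h hP] := KL _ _ _ _ jr f; have [g gP] := ext1_extend h AW iq.
by exists (r \o g) => x; rewrite /= gP hP.
Qed.

(** The last clause places the syzygy of A inside the first factor of the cover of B, so that maps
    on PA * PC can be restricted to PA compatibly with syzygies. *)
Lemma horseshoe A B C (KA PA KC PC : lmodType R) (f : {linear A -> B}) (g : {linear B -> C})
    (kA : {linear KA -> PA}) (pA : {linear PA -> A})
    (kC : {linear KC -> PC}) (pC : {linear PC -> C}) :
  ses f g -> ses kA pA -> ses kC pC -> projective PC ->
  exists (KB : lmodType R) (kB : {linear KB -> (PA * PC)%type}) (pB : {linear (PA * PC)%type -> B})
    (u : {linear KA -> KB}) (v : {linear KB -> KC}),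
    [/\ ses kB pB, ses u v & forall x, kB (u x) = (kA x, 0)].
Proof.
move=> fg kpA kpC PCproj; have [h hP] := PCproj _ _ _ pC (ses_surj fg).
pose pB : {linear (PA * PC)%type -> B} := pair_map (f \o pA) h.
have gpB z : g (pB z) = pC z.2.
  by rewrite /pB /= /pair_map linearD /= (ses_comp fg) hP add0r.
have pBS : onto pB.
  move=> b; have [y yP] := ses_surj kpC (g b).
  have [|a aP] := ses_ker fg (y := b - h y).
    by rewrite linearB hP yP subrr.
  have [x xP] := ses_surj kpA a.
  by exists (x, y); rewrite /pB /= /pair_map /= xP aP subrK.
have [KB [kB kpB]] := has_kernel pBS.
have [x|u uP] := factor_inj (f := @inl_lin R PA PC \o kA) (ses_inj kpB).
  by apply: (ses_ker kpB); rewrite /pB /= /pair_map /= (ses_comp kpA) !linear0 addr0.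
have [x|v vP] := factor_inj (f := @snd_lin R PA PC \o kB) (ses_inj kpC).
  by apply: (ses_ker kpC); rewrite /= -gpB (ses_comp kpB) linear0.
exists _, kB, pB, u, v; split=> //; split.
- apply: inj_linear => x ux; apply: (ses_inj kpA); rewrite linear0.
  by have := uP x; rewrite ux linear0 => -[<-].
- move=> z; have [|a aP] := ses_ker fg (y := - h (kC z)).
    by rewrite linearN hP (ses_comp kpC) oppr0.
  have [x xP] := ses_surj kpA a.
  have [|y yP] := ses_ker kpB (y := (x, kC z)).
    by rewrite /pB /= /pair_map /= xP aP addNr.
  by exists y; apply: (ses_inj kpC); rewrite vP /= yP.
- move=> y vy0; have := vP y; rewrite vy0 linear0 /=.
  case ky: (kB y) => [x z] /= z0; rewrite -z0 in ky.
  have /(ses_ker kpA)[w wx] : pA x = 0.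
    apply: (ses_inj fg); rewrite linear0; have := ses_comp kpB y.
    by rewrite ky /pB /= /pair_map /= linear0 addr0.
  by exists w; apply: (ses_inj kpB); rewrite uP /= wx ky.
- move=> x; apply: (ses_inj kpC); rewrite vP /= linear0.
  by rewrite uP.
Qed.

(** The piece Ext^1(L, V) -> Ext^1(M, V) -> Ext^2(D, V) of the long exact sequence, with the last
    term written as Ext^1(KD, V). A map on the syzygy of M extends to the syzygy of L, then to the
    cover of L, and is finally restricted to the cover of M. *)
Lemma ext1_sub M L D V (KD : lmodType R) P (f : {linear M -> L}) (g : {linear L -> D})
    (i : {linear KD -> P}) (q : {linear P -> D}) :
  ses f g -> projective P -> ses i q -> ext1_zero L V -> ext1_zero KD V ->
  ext1_zero M V.
Proof.
move=> fg Pproj iq LV KV; have kpM := ses_kernel (@free_cover_surj R M).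
have [KL [kL [pL [u [v [kpL uv uP]]]]]] := horseshoe fg kpM iq Pproj.
apply: (ext1_of_cover (@free_projective R M) kpM) => h.
have [h1 h1P] := ext1_extend h KV uv.
have [h2 h2P] := ext1_extend h1 LV kpL.
by exists (h2 \o @inl_lin R _ _) => x; rewrite -h1P -h2P uP.
Qed.

End ExtVanishing.

(** * Pushouts, quotients of quotients, prolonged extensions *)

Section Pushouts.
Variable R : pzRingType.
Implicit Types A B C D E F K L M P S U V W : lmodType R.

Definition is_pushout K A B E (f : {linear K -> A}) (g : {linear K -> B})
    (a : {linear A -> E}) (b : {linear B -> E}) :=
  (forall e, exists x y, e = a x + b y) /\
  (forall x y, a x = b y <-> exists k, f k = x /\ g k = y).

Lemma is_pushout_sym K A B E (f : {linear K -> A}) (g : {linear K -> B})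
    (a : {linear A -> E}) (b : {linear B -> E}) :
  is_pushout f g a b -> is_pushout g f b a.
Proof.
move=> [abS abP]; split=> [e|y x].
  by have [x [y ->]] := abS e; exists y, x; rewrite addrC.
split=> [e|[k [gk fk]]].
  by have /abP[k [fk gk]] := esym e; exists k.
by apply/esym/abP; exists k.
Qed.

Lemma pushout_map K A B E C (f : {linear K -> A}) (g : {linear K -> B})
    (a : {linear A -> E}) (b : {linear B -> E})
    (s : {linear A -> C}) (t : {linear B -> C}) :
  is_pushout f g a b -> (forall k, s (f k) = t (g k)) ->
  exists h : {linear E -> C}, (forall x, h (a x) = s x) /\ (forall y, h (b y) = t y).
Proof.
move=> [abS abP] st.
have abS' : onto (pair_map a b).
  by move=> e; have [x [y ->]] := abS e; exists (x, y).
have [|h hP] := factor_surj (f := pair_map s t) abS'.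
  move=> [x y] /eqP; rewrite /= /pair_map /= addr_eq0 -linearN => /eqP/abP[k [<- gk]].
  by rewrite /= st gk linearN addNr.
exists h; split=> z.
  by have := hP (z, 0); rewrite /= /pair_map /= !linear0 !addr0.
by have := hP (0, z); rewrite /= /pair_map /= !linear0 !add0r.
Qed.

Lemma pushout_ses K A B E C (f : {linear K -> A}) (g : {linear K -> B})
    (c : {linear B -> C}) (a : {linear A -> E}) (b : {linear B -> E}) :
  is_pushout f g a b -> ses g c ->
  exists p : {linear E -> C}, ses a p /\ forall y, p (b y) = c y.
Proof.
move=> ab gc; have [k|p [pa pb]] := pushout_map (s := \0) (t := c) ab.
  by rewrite (ses_comp gc).
have [abS abP] := ab; exists p; split=> //; split=> //.
- apply: inj_linear => x; rewrite -(linear0 b) => /abP[k [<-]].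
  by rewrite -(linear0 g) => /(ses_inj gc) ->; rewrite linear0.
- by move=> z; have [y <-] := ses_surj gc z; exists (b y).
- move=> e; have [x [y ->]] := abS e; rewrite linearD pa pb add0r.
  move=> /(ses_ker gc)[k <-]; exists (x + f k); rewrite linearD; congr (_ + _).
  by apply/abP; exists k.
Qed.

(** Third isomorphism theorem for A inside B inside D: the quotient Q = D / A contains C = B / A,
    with quotient F = D / B. *)
Lemma ses_third A B C D F (f : {linear A -> B}) (g : {linear B -> C})
    (e : {linear B -> D}) (h : {linear D -> F}) :
  ses f g -> ses e h ->
  exists (Q : lmodType R) (c : {linear D -> Q}) (i : {linear C -> Q})
      (d : {linear Q -> F}), ses (e \o f) c /\ ses i d.
Proof.
move=> fg eh; pose ef : {linear A -> D} := e \o f.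
have efI : injective ef by move=> x y /(ses_inj eh)/(ses_inj fg).
have [Q [c efc]] : exists (Q : lmodType R) (c : {linear D -> Q}), ses ef c.
  by exists _, (coker_proj ef); exact: ses_coker.
have [|i iP] := factor_surj (f := c \o e) (ses_surj fg).
  by move=> x /(ses_ker fg)[a <-]; exact: (ses_comp efc a).
have [|d dP] := factor_surj (f := h) (ses_surj efc).
  by move=> x /(ses_ker efc)[a <-]; exact: (ses_comp eh).
exists Q, c, i, d; split=> //; split.
- apply: inj_linear => y; have [x <-] := ses_surj fg y; rewrite iP.
  by move=> /(ses_ker efc)[a /(ses_inj eh) <-]; exact: ses_comp fg a.
- by move=> z; have [x <-] := ses_surj eh z; exists (c x).
- move=> z; have [x <-] := ses_surj efc z; rewrite dP => /(ses_ker eh)[y <-].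
  by exists (g y); rewrite iP.
- move=> y; have [x <-] := ses_surj fg y; rewrite iP /= dP.
  exact: ses_comp eh x.
Qed.

(* The extension [U] of [C] by [S] is prolonged to an extension of [L] by [S];
   the obstruction lies in $\mathrm{Ext}^2(D, S) = \mathrm{Ext}^1(K, S)$. *)
Lemma prolong_extension S U C L D K P (b : {linear S -> U}) (q : {linear U -> C})
    (c : {linear C -> L}) (d : {linear L -> D})
    (i : {linear K -> P}) (p : {linear P -> D}) :
  ses b q -> ses c d -> projective P -> ses i p -> ext1_zero K S ->
  exists (U' : lmodType R) (u : {linear U -> U'}) (t : {linear U' -> D})
      (q' : {linear U' -> L}), ses u t /\ ses (u \o b) q'.
Proof.
move=> bq cd Pproj ip KS; have [l lP] := Pproj _ _ _ p (ses_surj cd).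
have [x|j jP] := factor_inj (f := l \o i) (ses_inj cd).
  by apply: (ses_ker cd); rewrite /= lP (ses_comp ip).
have [h hP] := KS _ _ _ _ bq j.
have [U' [u [v uv]]] := pushout h i; have [t [ut tP]] := pushout_ses uv ip.
have [k|q' [q'u q'v]] := pushout_map (s := c \o q) (t := l) uv.
  by rewrite /= hP jP.
exists U', u, t, q'; split=> //; have [uvS uvP] := uv; split.
- by move=> x y /(ses_inj ut)/(ses_inj bq).
- move=> z; have [y yP] := ses_surj ip (d z).
  have [|w wP] := ses_ker cd (y := z - l y).
    by rewrite linearB lP yP subrr.
  have [x xP] := ses_surj bq w.
  by exists (u x + v y); rewrite linearD q'u q'v /= xP wP subrK.
- move=> e; have [x [y ->]] := uvS e; rewrite linearD q'u q'v => qxy.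
  have /(ses_ker ip)[k ky] : p y = 0.
    by rewrite -lP -[RHS](linear0 d) -qxy linearD (ses_comp cd) add0r.
  have /(ses_ker bq)[s bs] : q (x + h k) = 0.
    by apply: (ses_inj cd); rewrite linearD hP linearD jP /= ky linear0.
  exists s; rewrite /= bs linearD; congr (_ + _).
  by apply/uvP; exists k.
- by move=> s; rewrite /= q'u /= (ses_comp bq) linear0.
Qed.

End Pushouts.

(** * Resolving classes and resolution dimension *)

Section Resolving.
Variable R : pzRingType.
Implicit Types A B C D E F K L M P S U V W : lmodType R.
Implicit Types X : lmodType R -> Prop.

Definition ext_closed X := forall A B C (f : {linear A -> B}) (g : {linear B -> C}),
  ses f g -> X A -> X C -> X B.
Definition ker_closed X := forall A B C (f : {linear A -> B}) (g : {linear B -> C}),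
  ses f g -> X B -> X C -> X A.
Definition retract_closed X := forall A B (i : {linear A -> B}) (r : {linear B -> A}),
  (forall x, r (i x) = x) -> X B -> X A.

Record resolving X : Prop := Resolving {
  res_ext : ext_closed X;
  res_ker : ker_closed X;
  res_retract : retract_closed X;
  res_proj : forall P, projective P -> X P }.

(** The class $\mathcal{X}^\wedge_n$, peeled off one syzygy at a time: inductions on n then avoid
    infinite sequences padded by zero objects. *)
Fixpoint res_le X n M : Prop :=
  if n is n'.+1 then
    exists (K P : lmodType R) (k : {linear K -> P}) (p : {linear P -> M}),
      [/\ ses k p, X P & res_le X n' K]
  else X M.

Lemma res_le_sub X X' n M : (forall N, X N -> X' N) -> res_le X n M -> res_le X' n M.
Proof.
move=> XX'; elim: n M => [|n IHn] M /=; first exact: XX'.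
by move=> [K [P [k [p [kp XP XK]]]]]; exists K, P, k, p; split; auto.
Qed.

Lemma retract_closed_iso X A B (h : {linear A -> B}) :
  retract_closed X -> iso h -> X A -> X B.
Proof.
move=> Xr [hI hS]; have [x //|r rP] := factor_inj (f := idfun) hI.
exact: (Xr _ _ r h).
Qed.

Lemma ext_closed_pair X A B : ext_closed X -> X A -> X B -> X (A * B)%type.
Proof. by move=> Xe; apply: Xe; exact: ses_pair. Qed.

Lemma res_cover X M : resolving X ->
  exists (K P : lmodType R) (k : {linear K -> P}) (p : {linear P -> M}),
    [/\ ses k p, projective P & X P].
Proof.
move=> Xr; exists _, (free_mod R M), (kernel_incl (@free_cover R M)), (@free_cover R M).
split; first exact: ses_kernel (@free_cover_surj R M).
  exact: free_projective.
exact/(res_proj Xr)/free_projective.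
Qed.

Lemma sub_res_le X n M : resolving X -> X M -> res_le X n M.
Proof.
move=> Xr; elim: n M => // n IHn M XM.
have [K [P [k [p [kp _ XP]]]]] := res_cover M Xr.
by exists K, P, k, p; split=> //; apply: IHn; exact: res_ker kp XP XM.
Qed.

Section Step.
Variables (X : lmodType R -> Prop) (n : nat).
Hypotheses (Xr : resolving X) (Xn : resolving (res_le X n)).

(* The pullback of [X0 -> M <- P] is an extension of [P] by a module of
   dimension at most [n], and also of [X0] by [K]. *)
Lemma syzygy_res_le M K P (k : {linear K -> P}) (p : {linear P -> M}) :
  ses k p -> projective P -> res_le X n.+1 M -> res_le X n K.
Proof.
move=> kp Pproj [L [X0 [l [q [lq XX0 XL]]]]].
have [h hP] := Pproj _ _ _ p (ses_surj lq).
have qhS : onto (pair_map q p).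
  by move=> x; have [y <-] := ses_surj lq x; exists (y, 0); rewrite /= /pair_map /= linear0 addr0.
have [E [e eqp]] := has_kernel qhS.
have [x|u uP] := factor_inj (f := @inl_lin R X0 P \o l) (ses_inj eqp).
  by apply: (ses_ker eqp); rewrite /= /pair_map /= (ses_comp lq) linear0 addr0.
have [x|v vP] := factor_inj (f := @inr_lin R X0 P \o k) (ses_inj eqp).
  by apply: (ses_ker eqp); rewrite /= /pair_map /= (ses_comp kp) linear0 addr0.
have eE x : q (e x).1 = - p (e x).2.
  by apply/eqP; rewrite -addr_eq0; apply/eqP; exact: ses_comp eqp x.
have XE : res_le X n E.
  apply: (res_ext Xn (f := u) (g := @snd_lin R X0 P \o e)) XL (res_proj Xn Pproj).
  split.
  - by move=> x y /(congr1 e); rewrite !uP => -[/(ses_inj lq)].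
  - move=> z; have [|x ex] := ses_ker eqp (y := (- h z, z)).
      by rewrite /= /pair_map /= linearN hP addNr.
    by exists x; rewrite /= ex.
  - move=> x /= e2; have := eE x; rewrite e2 linear0 oppr0 => /(ses_ker lq)[y ly].
    exists y; apply: (ses_inj eqp); rewrite uP /= /into_pair /= ly.
    by case: (e x) e2 => /= ? ? ->.
  - by move=> x; rewrite /= uP.
apply: (res_ker Xn (f := v) (g := @fst_lin R X0 P \o e)) XE (sub_res_le n Xr XX0).
split.
- by move=> x y /(congr1 e); rewrite !vP => -[/(ses_inj kp)].
- move=> z; have [y yP] := ses_surj kp (- q z).
  have [|x ex] := ses_ker eqp (y := (z, y)).
    by rewrite /= /pair_map /= yP subrr.
  by exists x; rewrite /= ex.
- move=> x /= e1; have := eE x; rewrite e1 linear0 => /esym/eqP; rewrite oppr_eq0.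
  move=> /eqP/(ses_ker kp)[y ky].
  exists y; apply: (ses_inj eqp); rewrite vP /= /into_pair /= ky.
  by case: (e x) e1 => /= ? ? ->.
- by move=> x; rewrite /= vP.
Qed.

Lemma res_leS_ext : ext_closed (res_le X n.+1).
Proof.
move=> A B C f g fg XA XC.
have [KA [PA [kA [pA [kpA PAproj XPA]]]]] := res_cover A Xr.
have [KC [PC [kC [pC [kpC PCproj XPC]]]]] := res_cover C Xr.
have [KB [kB [pB [u [v [kpB uv _]]]]]] := horseshoe fg kpA kpC PCproj.
exists KB, (PA * PC)%type, kB, pB; split=> //.
  exact: (ext_closed_pair (res_ext Xr)).
by apply: (res_ext Xn uv); [exact: syzygy_res_le kpA _ _|exact: syzygy_res_le kpC _ _].
Qed.

Lemma res_leS_ker : ker_closed (res_le X n.+1).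
Proof.
move=> A B C f g fg XB XC.
have [KA [PA [kA [pA [kpA PAproj XPA]]]]] := res_cover A Xr.
have [KC [PC [kC [pC [kpC PCproj XPC]]]]] := res_cover C Xr.
have [KB [kB [pB [u [v [kpB uv _]]]]]] := horseshoe fg kpA kpC PCproj.
exists KA, PA, kA, pA; split=> //; apply: (res_ker Xn uv).
  by apply: syzygy_res_le kpB _ _ => //; exact: projective_pair.
exact: syzygy_res_le kpC _ _.
Qed.

(* The lifts [s] and [t] of [i] and [r] satisfy [t \o s = id] only up to a map
   into [KA]; hence [KA] is a retract of [KB * PA]. *)
Lemma res_leS_retract : retract_closed (res_le X n.+1).
Proof.
move=> A B i r ri XB.
have [KA [PA [kA [pA [kpA PAproj XPA]]]]] := res_cover A Xr.
have [KB [PB [kB [pB [kpB PBproj XPB]]]]] := res_cover B Xr.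
exists KA, PA, kA, pA; split=> //.
have XKB := syzygy_res_le kpB PBproj XB.
have [s sP] := PAproj _ _ _ (i \o pA) (ses_surj kpB).
have [t tP] := PBproj _ _ _ (r \o pB) (ses_surj kpA).
have [x|s' s'P] := factor_inj (f := s \o kA) (ses_inj kpB).
  by apply: (ses_ker kpB); rewrite /= sP /= (ses_comp kpA) linear0.
have [x|t' t'P] := factor_inj (f := t \o kB) (ses_inj kpA).
  by apply: (ses_ker kpA); rewrite /= tP /= (ses_comp kpB) linear0.
have [x|d dP] := factor_inj (f := idfun \- (t \o s)) (ses_inj kpA).
  by apply: (ses_ker kpA); rewrite /= linearB tP /= sP /= ri subrr.
have XKP : res_le X n (KB * PA)%type.
  apply: (ext_closed_pair (res_ext Xn) XKB); exact: sub_res_le Xr XPA.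
apply: (res_retract Xn (i := into_pair s' kA) (r := pair_map t' d)) XKP => x.
apply: (ses_inj kpA); rewrite /= /pair_map /= linearD t'P dP /= s'P.
by rewrite addrCA subrr addr0.
Qed.

End Step.

Lemma res_le_resolving X n : resolving X -> resolving (res_le X n).
Proof.
move=> Xr; elim: n => // n IHn; split.
- exact: res_leS_ext.
- exact: res_leS_ker.
- exact: res_leS_retract.
- by move=> P Pproj; apply: sub_res_le => //; exact: res_proj.
Qed.

End Resolving.

(** * Auslander-Buchweitz approximations and the embedding at one vertex *)

Section AuslanderBuchweitz.
Variables (R : pzRingType) (X w : lmodType R -> Prop) (m : nat).
Implicit Types A B C D E F K L M N P Q S U V W : lmodType R.

Definition ext1_perp (Z : lmodType R -> Prop) V := forall A, Z A -> ext1_zero A V.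

Hypothesis X_res : resolving X.
Hypothesis Xw0 : forall A V, X A -> w V -> ext1_zero A V.
Hypothesis wX : forall A, w A -> X A.
Hypothesis cogen : forall A, X A -> exists W D (f : {linear A -> W}) (g : {linear W -> D}),
  [/\ ses f g, w W & X D].

(** Ext^1(A, V) sits between Ext^1(A, W) = 0 and Ext^1(K, L), where the syzygy K of A is again in X
    and L has a shorter resolution than V. *)
Lemma ext1_res_le n A V : X A -> res_le w n V -> ext1_zero A V.
Proof.
elim: n A V => [|n IHn] A V XA; first exact: Xw0.
move=> [L [W [j [r [jr wW wL]]]]].
have [K [P [k [p [kp Pproj XP]]]]] := res_cover A X_res.
apply: (ext1_shift Pproj kp jr (IHn _ _ _ wL) (Xw0 XA wW)).
exact: (res_ker X_res kp).
Qed.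

(** Embed the syzygy K of M into L by induction and push X0 out along this embedding. The pushout E
    is an extension of D by X0, hence in X, and E / L = M. Embedding E into some W in w gives M
    inside W / L, where W / L has dimension at most n + 1 and its quotient by M is W / E, in X. *)
Lemma ab_approximation n M : res_le X n M ->
  exists L D (f : {linear M -> L}) (g : {linear L -> D}),
    [/\ ses f g, res_le w n L & X D].
Proof.
elim: n M => [|n IHn] M; first exact: cogen.
move=> [K [X0 [k [p [kp XX0 /IHn[L [D [f [g [fg wL XD]]]]]]]]]].
have [E [a [b ab]]] := pushout k f.
have [q [aq _]] := pushout_ses ab fg.
have [r [br _]] := pushout_ses (is_pushout_sym ab) kp.
have [W [D' [e [e' [ee' wW XD']]]]] := cogen (res_ext X_res aq XX0 XD).
have [Q [c [i [d [bc id]]]]] := ses_third br ee'.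
by exists Q, D', i, d; split=> //; exists L, W, (e \o b), c.
Qed.

(** Both conditions on V are used: Ext^1(L, V) = 0 because V is orthogonal to W, and Ext^2(D, V) =
    Ext^1(K, V) = 0 because K is in X and V is in W. *)
Lemma ext1_ab M V : res_le X m M -> res_le w m V -> ext1_perp (res_le w m) V ->
  ext1_zero M V.
Proof.
move=> XM wV pV; have [L [D [f [g [fg wL XD]]]]] := ab_approximation XM.
have [K [P [k [p [kp Pproj XP]]]]] := res_cover D X_res.
apply: (ext1_sub fg Pproj kp (pV _ wL)); apply: ext1_res_le wV.
exact: (res_ker X_res kp).
Qed.

Hypothesis cot : forall N, (forall V, ext1_perp (res_le w m) V -> ext1_zero N V) -> res_le w m N.
Hypothesis cot_envelope : forall M, exists V L (f : {linear M -> V}) (g : {linear V -> L}),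
  [/\ ses f g, ext1_perp (res_le w m) V & res_le w m L].

Lemma cot_ext_closed : ext_closed (res_le w m).
Proof.
move=> A B C f g fg wA wC; apply: cot => V pV.
by apply: (ext1_extension fg); exact: pV.
Qed.

(** Lifts out of a direct sum are chosen summand by summand, so a left orthogonal class is closed
    under arbitrary direct sums. *)
Lemma cot_dsum (I : choiceType) (V : I -> lmodType R) :
  (forall i, res_le w m (V i)) -> res_le w m (dsum V).
Proof. by move=> wV; apply: cot => W pW; apply: ext1_dsum => i; exact/pW. Qed.

Lemma cot_retract_closed : retract_closed (res_le w m).
Proof.
by move=> A B i r ri wB; apply: cot => V pV; apply: ext1_retract_l ri _; exact: pV.
Qed.

Lemma res_le_w_X N : res_le w m N -> res_le X m N.
Proof. exact: res_le_sub. Qed.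

(* [V] is obtained from the pushout [U] of [S] and [A] over [S0] by prolonging
   the extension [S -> U -> C] along an approximation of [C], and then taking a
   special preenvelope. *)
Lemma envelope_step S0 A C S (f : {linear S0 -> A}) (c : {linear A -> C})
    (e : {linear S0 -> S}) :
  ses f c -> res_le X m C -> injective e -> res_le w m S ->
  exists V (a : {linear A -> V}) (b : {linear S -> V}),
    [/\ injective a, injective b,
        forall x y, a x = b y <-> exists s, f s = x /\ e s = y,
        res_le w m V /\ ext1_perp (res_le w m) V &
        (exists Q (q : {linear V -> Q}), ses b q /\ res_le w m Q) /\
        exists N (q : {linear V -> N}), [/\ onto q, res_le X m N &
          forall v, q v = 0 <-> exists x y, v = a x + b y]].
Proof.
move=> fc XC eI wS; have XrM := res_le_resolving m X_res.
have [U [a [b ab]]] := pushout f e.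
have [p [ap _]] := pushout_ses ab (ses_coker eI).
have [q [bq _]] := pushout_ses (is_pushout_sym ab) fc.
have [L [D [i [d [idd wL XD]]]]] := ab_approximation XC.
have [K [P [k [r [kr Pproj XP]]]]] := res_cover D X_res.
have XK : X K by exact: (res_ker X_res kr).
have [U' [u [t [q' [ut ubq']]]]] :=
  prolong_extension bq idd Pproj kr (ext1_res_le XK wS).
have [V [L' [v [v' [vv' pV wL']]]]] := cot_envelope U'.
(* Here Q = V / S is an extension of L' by L, hence in W, and N = V / U is an extension of L' by D,
   hence of X-dimension at most m. As U is spanned by A and S, N is the quotient of V by both
   images. *)
have [Q [c1 [i1 [d1 [bc1 id1]]]]] := ses_third ubq' vv'.
have [N [c2 [i2 [d2 [uc2 id2]]]]] := ses_third ut vv'.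
have wQ := cot_ext_closed id1 wL wL'.
have XN : res_le X m N.
  by apply: (res_ext XrM id2); [exact: sub_res_le|exact: res_le_w_X].
have [abS abP] := ab.
have vuI : injective (v \o u) by move=> x y /(ses_inj vv')/(ses_inj ut).
exists V, ((v \o u) \o a), (v \o (u \o b)); split.
- by move=> x y /vuI/(ses_inj ap).
- by move=> x y /vuI/(ses_inj bq).
- by move=> x y; split=> [/vuI/abP //|/abP xy]; rewrite /= xy.
- by split=> //; exact: cot_ext_closed bc1 wS wQ.
split; first by exists Q, c1.
exists N, c2; split=> //; first exact: ses_surj uc2.
move=> z; split=> [/(ses_ker uc2)[z' <-]|[x [y ->]]].
  by have [x [y ->]] := abS z'; exists x, y; rewrite /= !linearD.
by rewrite -[_ + _](linearD (v \o u)) (ses_comp uc2).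
Qed.

End AuslanderBuchweitz.

(** * Yoneda extensions *)

Section ExactSequences.
Variable C : preadditive.
Implicit Types A B D K P V Z : C.

Lemma kernel_mono K A B (k : Hom K A) (f : Hom A B) : is_kernel k f -> is_mono k.
Proof.
move=> [fk kU] T g h kgh.
have [|u [_ uU]] := kU T (k ∘ g); first by rewrite compA fk comp0m.
by rewrite -(uU g) // -(uU h).
Qed.

Lemma is_kernel_comp_mono K A B D (k : Hom K A) (f : Hom A B) (g : Hom B D) :
  is_mono g -> is_kernel k f <-> is_kernel k (g ∘ f).
Proof.
move=> gM; split=> -[fk kU].
  split=> [|T t]; first by rewrite -compA fk compm0.
  by rewrite -compA -(compm0 T g) => /gM; exact: kU.
split=> [|T t ft]; last by apply: kU; rewrite -compA ft compm0.
by apply: gM; rewrite compm0 compA.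
Qed.

Lemma is_zero_from Z A (f g : Hom Z A) : is_zero Z -> f = g.
Proof. by move=> Z0; rewrite -[f]compm1 -[g]compm1 Z0 !compm0. Qed.

Lemma is_zero_to Z A (f g : Hom A Z) : is_zero Z -> f = g.
Proof. by move=> Z0; rewrite -[f]comp1m -[g]comp1m Z0 !comp0m. Qed.

Lemma exact_at_zero A Z B (f : Hom A Z) (g : Hom Z B) : is_zero Z -> exact_at f g.
Proof.
move=> Z0; exists Z, f, (idm Z); split; first by rewrite comp1m.
  by move=> T t u _; exact: is_zero_from.
split=> [|T t _]; first exact: is_zero_from.
by exists t; split=> [|u _]; [rewrite comp1m|exact: is_zero_to].
Qed.

Section Cons.
Variables (K P A : C) (k : Hom K P) (p : Hom P A).
Hypotheses (kp : is_kernel k p) (pE : is_epi p).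
Variable E : exact_seq K.

Definition cons_term n : C := if n is n'.+1 then E n' else P.
Definition cons_dif n : Hom (cons_term n.+1) (cons_term n) :=
  if n is n'.+1 then dif E n' else k ∘ aug E.

Lemma cons_exact0 : exact_at (cons_dif 0) p.
Proof. by exists K, (aug E), k; split=> //; exact: aug_epi. Qed.

Lemma cons_exactS n : exact_at (cons_dif n.+1) (cons_dif n).
Proof.
case: n => [|n]; last exact: exactS.
have [L [e [l [dE eE lK]]]] := exact0 E; exists L, e, l; split=> //.
exact/(is_kernel_comp_mono _ _ (kernel_mono kp)).
Qed.

Definition cons_seq : exact_seq A :=
  @ExactSeq C A cons_term cons_dif p pE cons_exact0 cons_exactS.

End Cons.

Section Tail.
Variables (A : C) (E : exact_seq A) (K : C) (e : Hom (E 1%N) K) (k : Hom K (E 0%N)).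
Hypotheses (dE : dif E 0 = k ∘ e) (eE : is_epi e) (kK : is_kernel k (aug E)).

Lemma tail_exact0 : exact_at (dif E 1) e.
Proof.
have [L [f [l [dE1 fE lK]]]] := exactS E 0; exists L, f, l; split=> //.
by apply/(is_kernel_comp_mono _ _ (kernel_mono kK)); rewrite -dE.
Qed.

Definition tail_seq : exact_seq K :=
  @ExactSeq C K (fun n => E n.+1) (fun n => dif E n.+1) e eE tail_exact0
    (fun n => exactS E n.+1).

End Tail.

Section Trivial.
Variables (Z V : C).
Hypothesis Z0 : is_zero Z.

Definition triv_term n : C := if n is _.+1 then Z else V.

Lemma triv_epi : is_epi (idm V).
Proof. by move=> T g h; rewrite !compm1. Qed.

Lemma triv_exact0 : exact_at (hzero : Hom Z V) (idm V).
Proof.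
exists Z, (idm Z), hzero; split; first by rewrite compm1.
  by move=> T g h; rewrite !compm1.
split=> [|T t]; first by rewrite comp1m.
rewrite comp1m => ->; exists hzero; split=> [|u _]; first by rewrite comp0m.
exact: is_zero_to.
Qed.

Lemma triv_exactS n : exact_at (hzero : Hom Z Z) (hzero : Hom Z (triv_term n)).
Proof. exact: exact_at_zero. Qed.

Definition triv_seq : exact_seq V :=
  @ExactSeq C V triv_term (fun n => hzero) (idm V) triv_epi triv_exact0 triv_exactS.

End Trivial.

Lemma resdim_leS X n A :
  resdim_le X n.+1 A <-> exists K P (k : Hom K P) (p : Hom P A),
    [/\ is_kernel k p, is_epi p, X P & resdim_le X n K].
Proof.
split=> [[E [EX E0]]|[K [P [k [p [kp pE XP [E [EX E0]]]]]]]].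
  have [K [e [k [dE eE kK]]]] := exact0 E.
  exists K, (E 0%N), k, (aug E); split=> //; [exact: aug_epi|exact: EX|].
  by exists (tail_seq dE eE kK); split=> i ni; [exact: EX|exact: E0].
by exists (cons_seq kp pE E); split=> -[|i] ni //=; [exact: EX|exact: E0].
Qed.

(** Kept transparent: morphisms out of it are defined by cases on the degree and need its term in
    degree i + 1 to reduce to [E i]. *)
Definition cons_ext n K P A V (k : Hom K P) (p : Hom P A) (kp : is_kernel k p)
    (pE : is_epi p) (E : extension n K V) : extension n.+1 A V.
Proof.
refine (@Extension C n.+1 A V (cons_seq kp pE E) _ (ext_end E) (ext_end_iso E)).
by case=> // i ni; exact: (ext_bounded E).
Defined.

Definition triv_ext Z V (Z0 : is_zero Z) : extension 0 V V.
Proof.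
refine (@Extension C 0 V V (triv_seq V Z0) _ (idm V) _).
  by case.
by exists (idm V); rewrite !comp1m.
Defined.

Definition tail_ext n A V (E : extension n.+1 A V) K (e : Hom (E 1%N) K)
    (k : Hom K (E 0%N)) (dE : dif E 0 = k ∘ e) (eE : is_epi e)
    (kK : is_kernel k (aug E)) : extension n K V.
Proof.
refine (@Extension C n K V (tail_seq dE eE kK) _ (ext_end E) (ext_end_iso E)).
by move=> i ni; exact: (ext_bounded E).
Defined.

(** The map on the right-hand end is allowed to vary, because induction on n replaces it by the
    induced map of syzygies, which is not an identity. *)
Definition ext_morph_over n A B V (f : Hom A B) (E : extension n A V)
    (E' : extension n B V) :=
  exists g : forall i, Hom (E i) (E' i),
    [/\ forall i, g i ∘ dif E i = dif E' i ∘ g i.+1,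
        aug E' ∘ g 0%N = f ∘ aug E
      & g n ∘ ext_end E = ext_end E'].

Lemma Ext_zero_of_initial n A V (Z : extension n A V) :
  (forall E : extension n A V, ext_morph_over (idm A) Z E) -> Ext_zero n A V.
Proof.
move=> ZE E E'.
have ZE' F : yoneda_equiv Z F.
  by apply: rst_step; have [g [g1 g2 g3]] := ZE F; exists g; split; rewrite // g2 comp1m.
by apply: rst_trans (ZE' E'); exact/rst_sym/ZE'.
Qed.

End ExactSequences.

(* [C] embedded in families of modules indexed by a set of points, with kernels,
   cokernels and factorizations computed pointwise.  This treats [Mod R] (one
   point) and [Rep Q R] (one point per vertex) at once. *)
Record concrete (R : pzRingType) (C : preadditive) : Type := Concrete {
  pt : Type;
  ev : pt -> C -> lmodType R;
  evm : forall i (A B : C), Hom A B -> {linear ev i A -> ev i B};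
  evm_faithful : forall (A B : C) (f g : Hom A B),
    (forall i x, evm i f x = evm i g x) -> f = g;
  evm1 : forall i (A : C) x, evm i (idm A) x = x;
  evmM : forall i (A B D : C) (g : Hom B D) (f : Hom A B) x,
    evm i (g ∘ f) x = evm i g (evm i f x);
  evm0 : forall i (A B : C) x, evm i (hzero : Hom A B) x = 0;
  evmD : forall i (A B : C) (f g : Hom A B) x,
    evm i (hadd f g) x = evm i f x + evm i g x;
  ev_kernel : forall (A B : C) (f : Hom A B), exists K (k : Hom K A),
    forall i, injective (evm i k) /\ forall x, evm i f x = 0 <-> exists y, evm i k y = x;
  ev_coker : forall (A B : C) (f : Hom A B), exists Q (q : Hom B Q),
    forall i, onto (evm i q) /\ forall x, evm i q x = 0 <-> exists y, evm i f y = x;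
  ev_factor_inj : forall (K A T : C) (k : Hom K A) (t : Hom T A),
    (forall i, injective (evm i k)) ->
    (forall i x, exists y, evm i k y = evm i t x) -> exists u : Hom T K, k ∘ u = t;
  ev_factor_surj : forall (A B T : C) (q : Hom A B) (t : Hom A T),
    (forall i, onto (evm i q)) ->
    (forall i x, evm i q x = 0 -> evm i t x = 0) -> exists u : Hom B T, u ∘ q = t;
  ev_biproduct : forall A B : C, exists M (i : Hom A M) (p : Hom M B) (s : Hom B M)
      (r : Hom M A),
    [/\ forall j, ses (evm j i) (evm j p), p ∘ s = idm B & r ∘ i = idm A] }.

Arguments ev {R C} c i A : rename.
Arguments evm {R C} c i {A B} f : rename.
Arguments ev_kernel {R C} c {A B} f : rename.
Arguments ev_coker {R C} c {A B} f : rename.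
Arguments ev_biproduct {R C} c A B : rename.

(** * Pointwise exactness, splitting, and vanishing of Yoneda Ext *)

Section Concrete.
Variables (R : pzRingType) (C : preadditive) (U : concrete R C).
Implicit Types A B D E K M P T V Z : C.

Definition pses A B D (f : Hom A B) (g : Hom B D) :=
  forall i, ses (evm U i f) (evm U i g).

Lemma pt_mono A B (f : Hom A B) : is_mono f <-> forall i, injective (evm U i f).
Proof.
split=> [fM i|fI T g h fgh].
  have [K [k kP]] := ev_kernel U f.
  have k0 : k = hzero.
    apply: fM; apply: (evm_faithful (c := U)) => j x; rewrite !evmM evm0 linear0.
    by apply/(kP j).2; exists x.
  by apply: inj_linear => x /(kP i).2[y <-]; rewrite k0 evm0.
apply: (evm_faithful (c := U)) => i x; apply: (fI i).
by rewrite -!evmM fgh.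
Qed.

Lemma pt_epi A B (f : Hom A B) : is_epi f <-> forall i, onto (evm U i f).
Proof.
split=> [fE i y|fS T g h gfh].
  have [Q [q qP]] := ev_coker U f.
  have q0 : q = hzero.
    apply: fE; apply: (evm_faithful (c := U)) => j x; rewrite !evmM evm0.
    by apply/(qP j).2; exists x.
  by apply/(qP i).2; rewrite q0 evm0.
apply: (evm_faithful (c := U)) => i y; have [x <-] := fS i y.
by rewrite -!evmM gfh.
Qed.

Lemma pt_kernel K A B (k : Hom K A) (f : Hom A B) :
  is_kernel k f <->
  forall i, injective (evm U i k) /\ forall x, evm U i f x = 0 <-> exists y, evm U i k y = x.
Proof.
split=> [kK i|kP]; first split.
- by move/(pt_mono k): (kernel_mono kK); exact.
- have [fk kU] := kK => x; split=> [fx|[y <-]]; last by rewrite -evmM fk evm0.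
  (* The pointwise kernel l is killed by f, so it factors through the categorical kernel k; every
     element killed by f therefore comes from K. *)
  have [L [l lP]] := ev_kernel U f.
  have [|u [ul _]] := kU L l.
    apply: (evm_faithful (c := U)) => j y; rewrite evmM evm0.
    by apply/(lP j).2; exists y.
  by have /(lP i).2[y <-] := fx; exists (evm U i u y); rewrite -evmM ul.
split=> [|T t ft].
  apply: (evm_faithful (c := U)) => i y; rewrite evmM evm0.
  by apply/(kP i).2; exists y.
have [i|i x|u ut] := ev_factor_inj (c := U) (k := k) (t := t).
- exact: (kP i).1.
- by apply/(kP i).2; rewrite -evmM ft evm0.
exists u; split=> // v vt; apply: (proj2 (pt_mono k)) => [i|]; last by rewrite ut.
exact: (kP i).1.
Qed.

Lemma pses_kernel A B D (f : Hom A B) (g : Hom B D) :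
  pses f g <-> is_kernel f g /\ is_epi g.
Proof.
split=> [fg|[/pt_kernel fK /pt_epi gE] i].
  split; last by apply/pt_epi => i; exact: ses_surj (fg i).
  apply/pt_kernel => i; split; first exact: ses_inj (fg i).
  by move=> x; split=> [/(ses_ker (fg i))|[y <-]] //; exact: ses_comp (fg i) y.
have [fI fP] := fK i; split=> // [y /fP //|x].
by apply/fP; exists x.
Qed.

Lemma pses_short_exact A B D (f : Hom A B) (g : Hom B D) :
  pses f g <-> short_exact f g.
Proof.
split=> [fg|[fK [_ gU]]]; last first.
  apply/pses_kernel; split=> // T s t st.
  have [|u [_ uU]] := gU T (s ∘ g); first by rewrite -compA fK.1 compm0.
  by rewrite -(uU s) // (uU t).
have /pses_kernel[fK gE] := fg; split=> //; split=> [|T t tf]; first exact: fK.1.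
have [i|i x /(ses_ker (fg i))[y <-]|u ut] :=
    ev_factor_surj (c := U) (q := g) (t := t).
- exact: ses_surj (fg i).
- by rewrite -evmM tf evm0.
by exists u; split=> // v vt; apply: (gE _ u v); rewrite ut vt.
Qed.

Lemma pt_exact A B D (f : Hom A B) (g : Hom B D) : exact_at f g ->
  forall i x, evm U i g x = 0 <-> exists y, evm U i f y = x.
Proof.
move=> [K [e [k [-> /pt_epi eE /pt_kernel kK]]]] i x.
rewrite (kK i).2; split=> -[y <-]; last by exists (evm U i e y); rewrite evmM.
by have [z <-] := eE i y; exists z; rewrite evmM.
Qed.

Lemma pt_zero Z : is_zero Z <-> forall i (x : ev U i Z), x = 0.
Proof.
split=> [Z0 i x|Z0]; first by rewrite -(evm1 x) Z0 evm0.
by apply: (evm_faithful (c := U)) => i x; rewrite [LHS]Z0 [RHS]Z0.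
Qed.

Lemma has_zero A : exists Z : C, is_zero Z.
Proof.
have [Z [z zP]] := ev_kernel U (idm A); exists Z; apply/pt_zero => i x.
by apply: (zP i).1; rewrite linear0 -[LHS]evm1; apply/(zP i).2; exists x.
Qed.

Lemma pt_isomorphism A B (f : Hom A B) : isomorphism f -> forall i, iso (evm U i f).
Proof.
move=> [g [gf fg]] i; split=> [x y e|y].
  by rewrite -[x]evm1 -[y]evm1 -gf !evmM e.
by exists (evm U i g y); rewrite -evmM fg evm1.
Qed.

Lemma onto_pses A B (p : Hom A B) : (forall i, onto (evm U i p)) ->
  exists K (k : Hom K A), pses k p.
Proof.
move=> pS; have [K [k kP]] := ev_kernel U p; exists K, k => i.
have [kI kE] := kP i; split=> // [y /kE //|x].
by apply/kE; exists x.
Qed.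

Definition lifts A V := forall E B (k : Hom V E) (p : Hom E B), pses k p ->
  forall g : Hom A B, exists h : Hom A E, p ∘ h = g.

Definition cprojective P := forall E B (p : Hom E B), (forall i, onto (evm U i p)) ->
  forall g : Hom P B, exists h : Hom P E, p ∘ h = g.

Lemma extension1_pses A V (E : extension 1 A V) :
  pses (dif E 0 ∘ ext_end E) (aug E).
Proof.
move=> i; have /pt_isomorphism/(_ i)[endI endS] := ext_end_iso E.
have E0 := pt_exact (exact0 E) (i := i); have E1 := pt_exact (exactS E 0) (i := i).
have /pt_zero E2 := ext_bounded E (isT : 1 < 2)%N.
split.
- apply: inj_linear => x; rewrite evmM => /E1[y]; rewrite (E2 i y) linear0 => x0.
  by apply: endI; rewrite -x0 linear0.
- by move/pt_epi: (@aug_epi _ _ E); exact.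
- by move=> y /E0[z <-]; have [x <-] := endS z; exists x; rewrite evmM.
- by move=> x; apply/E0; exists (evm U i (ext_end E) x); rewrite evmM.
Qed.

Definition ses_ext A B V (k : Hom V B) (p : Hom B A) (kp : pses k p) Z
    (Z0 : is_zero Z) : extension 1 A V :=
  cons_ext ((pses_kernel k p).1 kp).1 ((pses_kernel k p).1 kp).2 (triv_ext V Z0).

(** The split extension of A by V maps to every extension of B by V over f: on V by the given
    inclusion, on A by a lift of f. *)
Lemma initial_extension1 A V : lifts A V ->
  exists Z : extension 1 A V, forall B (f : Hom A B) (E : extension 1 B V),
    ext_morph_over f Z E.
Proof.
move=> AV; have [M [i [p [s [r [ip ps ri]]]]]] := ev_biproduct U V A.
have [Z Z0] := has_zero A.
exists (ses_ext ip Z0) => B f E; have kE := extension1_pses E.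
have [h hP] := AV _ _ _ _ kE f.
pose g0 : Hom M (E 0%N) := hadd (dif E 0 ∘ ext_end E ∘ r) (h ∘ p).
have g0i : g0 ∘ i = dif E 0 ∘ ext_end E.
  rewrite compDl -!compA ri compm1; have -> : p ∘ i = hzero.
    by apply: (evm_faithful (c := U)) => j x; rewrite evmM (ses_comp (ip j)) evm0.
  by rewrite compm0 addm0.
have g0p : aug E ∘ g0 = f ∘ p.
  rewrite compDr !compA hP; have -> : aug E ∘ dif E 0 ∘ ext_end E = hzero.
    apply: (evm_faithful (c := U)) => j x; rewrite -compA evmM.
    by rewrite (ses_comp (kE j)) evm0.
  by rewrite comp0m hadd0.
pose g n : Hom (ses_ext ip Z0 n) (E n) :=
  match n with 0 => g0 | 1 => ext_end E | n'.+2 => hzero end.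
exists g; split=> //=; last by rewrite compm1.
move=> [|[|n]] /=; rewrite ?compm1 ?g0i ?compm0 //; exact: is_zero_from.
Qed.

(* A projective cover of [A] maps to the first term of any extension; the rest
   of the morphism lies over the induced map of syzygies. *)
Lemma initial_extension (Y : obj_class C) V n A :
  (forall A, Y A -> lifts A V) ->
  (forall A, Y A -> exists K P (k : Hom K P) (p : Hom P A),
     [/\ pses k p, cprojective P & Y K]) ->
  Y A -> exists Z : extension n.+1 A V, forall B (f : Hom A B) (E : extension n.+1 B V),
    ext_morph_over f Z E.
Proof.
move=> YV Ycov; elim: n A => [|n IHn] A YA; first exact: initial_extension1 (YV _ YA).
have [K [P [k [p [kp Pproj YK]]]]] := Ycov _ YA.
have [Z ZP] := IHn _ YK; have /pses_kernel[kK pE] := kp.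
exists (cons_ext kK pE Z) => B f E.
have [L [e [l [dE eE lK]]]] := exact0 E.
have /pt_epi augS := @aug_epi _ _ E.
have [g0 g0P] := Pproj _ _ _ augS (f ∘ p).
have /pt_kernel lP := lK.
have [i|i x|h hP] := ev_factor_inj (c := U) (k := l) (t := g0 ∘ k).
- exact: (lP i).1.
- by apply/(lP i).2; rewrite -evmM compA g0P -compA kK.1 compm0 evm0.
have [g [g1 g2 g3]] := ZP _ h (tail_ext dE eE lK).
pose g' i : Hom (cons_ext kK pE Z i) (E i) :=
  match i with 0 => g0 | i'.+1 => g i' end.
exists g'; split=> //= -[|i] /=; last exact: g1.
by rewrite dE compA -hP -compA -g2 compA.
Qed.

Lemma Ext_zero_of_lifts (Y : obj_class C) V n A :
  (forall A, Y A -> lifts A V) ->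
  (forall A, Y A -> exists K P (k : Hom K P) (p : Hom P A),
     [/\ pses k p, cprojective P & Y K]) ->
  Y A -> (0 < n)%N -> Ext_zero n A V.
Proof.
case: n => // n YV Ycov YA _; have [Z ZP] := initial_extension n YV Ycov YA.
exact: Ext_zero_of_initial (ZP A (idm A)).
Qed.

Lemma Ext_zero1_of_lifts V A : lifts A V -> Ext_zero 1 A V.
Proof.
move=> /initial_extension1[Z ZP]; exact: Ext_zero_of_initial (ZP A (idm A)).
Qed.

Definition split_ext A V (E : extension 1 A V) :=
  exists s : Hom A (E 0%N), aug E ∘ s = idm A.

(** [yoneda_equiv] consists of zigzags, so both directions are wanted. Transport against the
    morphism rests on the five lemma, which makes [f 0] bijective at each point and so provides
    g. *)
Lemma split_ext_morph A V (E E' : extension 1 A V) :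
  extension_morph E E' -> split_ext E <-> split_ext E'.
Proof.
move=> [f [f1 f2 f3]]; split=> [[s sP]|[s sP]].
  by exists (f 0%N ∘ s); rewrite compA f2.
have EP := extension1_pses E; have EP' := extension1_pses E'.
have fk : f 0%N ∘ (dif E 0 ∘ ext_end E) = dif E' 0 ∘ ext_end E'.
  by rewrite compA f1 -compA f3.
have [i|i y|g gP] := ev_factor_inj (c := U) (k := f 0%N) (t := idm (E' 0%N)).
- apply: inj_linear => x fx0.
  have [|v vx] := ses_ker (EP i) (y := x); first by rewrite -f2 evmM fx0 linear0.
  have v0 : v = 0.
    apply: (ses_inj (EP' i)); rewrite linear0 -fk [LHS]evmM vx; exact: fx0.
  by rewrite -vx v0 linear0.
- have [x xP] := ses_surj (EP i) (evm U i (aug E') y).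
  have [|v vP] := ses_ker (EP' i) (y := y - evm U i (f 0%N) x).
    by rewrite linearB -evmM f2 xP subrr.
  exists (evm U i (dif E 0 ∘ ext_end E) v + x).
  by rewrite linearD -evmM fk vP subrK evm1.
by exists (g ∘ s); rewrite -f2 compA -[_ ∘ g]compA gP compm1.
Qed.

(** The given extension is equivalent to the split one, and splitness is preserved by each step of
    the equivalence. *)
Lemma Ext_zero1_section A V B (k : Hom V B) (p : Hom B A) :
  Ext_zero 1 A V -> pses k p -> exists s : Hom A B, p ∘ s = idm A.
Proof.
move=> AV kp; have [Z Z0] := has_zero A.
have [M [i [q [t [r [iq qt ri]]]]]] := ev_biproduct U V A.
suff [s sP] : split_ext (ses_ext kp Z0) by exists s.
have := AV (ses_ext iq Z0) (ses_ext kp Z0).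
have : split_ext (ses_ext iq Z0) by exists t.
move: (ses_ext iq Z0) (ses_ext kp Z0) => E E' sE EE'.
suff : split_ext E <-> split_ext E' by case=> + _; exact.
elim: EE' {sE} => {E E'} [E E' /split_ext_morph //|//|E E' _ IH|E1 E2 E3 _ IH _ IH'].
  by rewrite IH.
by rewrite IH.
Qed.

Lemma direct_summand_retract A B : direct_summand A B ->
  exists (i : Hom A B) (r : Hom B A), r ∘ i = idm A.
Proof. by move=> [A' [i [p [i' [p' [pi _ _ _ _]]]]]]; exists i, p. Qed.

End Concrete.

(** * Categorical notions for modules in terms of elements *)

Section ModuleCategory.
Variable R : pzRingType.
Implicit Types X w : lmodType R -> Prop.

(** Kept transparent, so that evaluation reduces to the identity and a statement at the point [tt]
    is one about the module itself. *)
Definition concrete_Mod : concrete R (Mod R).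
Proof.
apply: (@Concrete R (Mod R) unit (fun _ A => A) (fun _ A B f => f)) => //.
- by move=> A B f g fg; apply: linear_ext => x; exact: (fg tt).
- move=> A B f; exists (kernel f : lmodType R), (kernel_incl f) => _.
  by split; [exact: kernel_incl_inj|exact: kernel_inclP].
- move=> A B f; exists (coker f : lmodType R), (coker_proj f) => _.
  by split; [exact: coker_proj_surj|exact: coker_projP].
- move=> K A T k t kI kt; have [u uP] := factor_inj (kI tt) (kt tt).
  by exists u; exact: linear_ext.
- move=> A B T q t qS qt; have [u uP] := factor_surj (qS tt) (qt tt).
  by exists u; exact: linear_ext.
- move=> A B; exists (((A : lmodType R) * (B : lmodType R))%type : lmodType R).
  exists (@inl_lin R A B), (@snd_lin R A B), (@inr_lin R A B), (@fst_lin R A B).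
  split; [by move=> _; exact: ses_pair| |]; exact: linear_ext.
Defined.

Lemma ses_Mod (A B D : lmodType R) (f : {linear A -> B}) (g : {linear B -> D}) :
  ses f g <-> short_exact (f : @Hom (Mod R) A B) (g : @Hom (Mod R) B D).
Proof. by rewrite -(pses_short_exact concrete_Mod); split=> [fg []|/(_ tt)]. Qed.

Lemma Ext_zero1_Mod (A V : Mod R) : Ext_zero 1 A V <-> ext1_zero (R := R) A V.
Proof.
split=> [AV|AV].
  apply: splits_ext1 => E k p kp.
  have [|s sP] := Ext_zero1_section (U := concrete_Mod) (k := k) (p := p) AV.
    by move=> [].
  by exists s => x; exact: (congr1 (fun f : {linear A -> A} => f x) sP).
apply: (Ext_zero1_of_lifts (U := concrete_Mod)) => E B k p kp g.
by have [h hP] := AV _ _ _ _ (kp tt) g; exists h; exact: linear_ext.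
Qed.

Lemma closed_extensions_Mod X : closed_extensions (C := Mod R) X -> ext_closed X.
Proof. by move=> Xe A B D f g /ses_Mod; exact: Xe. Qed.

Lemma closed_epi_kernels_Mod X : closed_epi_kernels (C := Mod R) X -> ker_closed X.
Proof.
move=> Xk A B D f g fg XB XD; apply: (Xk _ _ _ f g XB XD).
  by apply/(pt_epi concrete_Mod) => i; exact: ses_surj fg.
by have /ses_Mod[] := fg.
Qed.

(** A retract of B splits off as a summand whose complement is the kernel of the retraction. *)
Lemma closed_summands_Mod X : closed_summands (C := Mod R) X -> retract_closed X.
Proof.
move=> Xs A B i r ri; apply: (Xs A B).
have rS : onto r by move=> x; exists (i x).
have [K [k kr]] := has_kernel rS.
have [x|q qP] := factor_inj (f := idfun \- (i \o r)) (ses_inj kr).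
  by apply: (ses_ker kr); rewrite linearB /= ri subrr.
exists K, i, r, k, q; split; apply: linear_ext => x //=.
- by apply: (ses_inj kr); rewrite qP /= (ses_comp kr) linear0 subr0.
- exact: ses_comp kr x.
- by apply: (ses_inj kr); rewrite qP /= ri subrr linear0.
- by rewrite qP /= addrC subrK.
Qed.

(** Closure under retracts enters as closure under isomorphism: a sequence 0 -> E_0 -> M -> 0 only
    makes M isomorphic to a member of X. *)
Lemma resdim_le_Mod X n (M : lmodType R) : retract_closed X ->
  resdim_le (C := Mod R) X n M <-> res_le X n M.
Proof.
move=> Xr; elim: n M => [|n IHn] M.
  split=> [[E [EX E0]]|XM] /=.
    apply: (retract_closed_iso (h := aug E) Xr); last exact: (EX 0%N).
    split; last by have /(pt_epi concrete_Mod)/(_ tt) := @aug_epi _ _ E.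
    apply: inj_linear => x /(pt_exact (U := concrete_Mod) (exact0 E) (i := tt))[y <-].
    have /(pt_zero concrete_Mod)/(_ tt) E1 := E0 1%N isT.
    by rewrite [y]E1; exact: linear0.
  have [Z Z0] := has_zero concrete_Mod M.
  by exists (@triv_seq (Mod R) Z M Z0); split; case.
rewrite resdim_leS; split=> -[K [P [k [p]]]].
  move=> [kp pE XP /IHn XK]; exists K, P, k, p; split=> //.
  by have /(pses_kernel concrete_Mod)/(_ tt) := conj kp pE.
move=> [kp XP /IHn XK]; exists K, P, k, p.
have /(pses_kernel concrete_Mod)[//] :
  pses concrete_Mod (k : @Hom (Mod R) K P) (p : @Hom (Mod R) P M) by move=> [].
Qed.

Section FrobeniusCotorsion.
Variables (X w : lmodType R -> Prop) (m : nat).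
Hypothesis frob : frobenius_pair (C := Mod R) X w.
Hypothesis cot : complete_cotorsion_pair (C := Mod R)
  (resdim_le (C := Mod R) w m) (right_perp1 (resdim_le (C := Mod R) w m)).

Let w_retract : retract_closed w := closed_summands_Mod (frob_summandsw frob).
Let X_retract : retract_closed X := closed_summands_Mod (frob_summands frob).

Lemma right_perp1_Mod N :
  right_perp1 (C := Mod R) (resdim_le (C := Mod R) w m) N <-> ext1_perp (res_le w m) N.
Proof.
split=> pN A wA; first exact/Ext_zero1_Mod/pN/resdim_le_Mod.
by apply/Ext_zero1_Mod/pN; exact/resdim_le_Mod.
Qed.

Lemma frob_cot N :
  (forall V, ext1_perp (res_le w m) V -> ext1_zero N V) -> res_le w m N.
Proof.
move=> NV; apply/resdim_le_Mod => //; apply/cot.1.2 => V /right_perp1_Mod pV.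
by apply/Ext_zero1_Mod/NV.
Qed.

Lemma frob_cot_envelope (M : lmodType R) :
  exists (V L : lmodType R) (f : {linear M -> V}) (g : {linear V -> L}),
    [/\ ses f g, ext1_perp (res_le w m) V & res_le w m L].
Proof.
have [_ [V [L [f [g [/ses_Mod fg wL /right_perp1_Mod pV]]]]]] := cot.2 M.
by exists V, L, f, g; split=> //; exact/resdim_le_Mod.
Qed.

Lemma frob_projective P : projective P -> X P.
Proof.
move=> Pproj; apply: (frob_sub frob).
have : res_le w m P by apply: frob_cot => V _; exact: projective_ext1.
case: m => // n [K [W [k [p [kp wW _]]]]].
have [s sP] := Pproj _ _ p idfun (ses_surj kp).
exact: (w_retract (i := s) (r := p)).
Qed.

Lemma frob_resolving : resolving X.
Proof.
split=> //; [exact: closed_extensions_Mod (frob_extensions frob)| |exact: frob_projective].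
exact: closed_epi_kernels_Mod (frob_epi_kernels frob).
Qed.

Lemma frob_ext1 A V : X A -> w V -> ext1_zero A V.
Proof. by move=> XA wV; apply/Ext_zero1_Mod; exact: (frob_ext frob). Qed.

Lemma frob_cogen_ses A : X A ->
  exists (W D : lmodType R) (f : {linear A -> W}) (g : {linear W -> D}), [/\ ses f g, w W & X D].
Proof.
move=> /(frob_cogen frob)[W [D [f [g [/ses_Mod fg wW XD]]]]].
by exists W, D, f, g.
Qed.

End FrobeniusCotorsion.
End ModuleCategory.

(** * Representations of quivers *)

Section Representations.
Variables (Q : quiver) (R : pzRingType).
Implicit Types F G H : Rep Q R.

Definition arrows_to (i : Q) : choiceType := {j : Q & arrow j i}.

Section RepOf.
Variables (V : Q -> lmodType R).
Variable b : forall i, {linear dsum (fun a : arrows_to i => V (tag a)) -> V i}.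

Definition arrow_map (j i : Q) (a : arrow j i) : {linear V j -> V i} :=
  b i \o dsum_inj (fun a : arrows_to i => V (tag a)) (Tagged (fun j => arrow j i) a).

Fixpoint path_map (i j : Q) (p : qpath i j) : {linear V i -> V j} :=
  match p with
  | qnil => lin_id (V i)
  | qcons _ _ p' a => lin_comp (arrow_map a) (path_map p')
  end.

Lemma path_map_cat (i j k : Q) (q : qpath j k) (p : qpath i j) :
  path_map (qcat q p) = lin_comp (path_map q) (path_map p).
Proof. by elim: q => [|k' l q IH a] /=; [|rewrite IH]; exact: linear_ext. Qed.

(** Paths form a free category, so the arrow maps suffice; they are bundled into the maps b_i, which
    become the phi_i, since these are what a recursion over the vertices produces. *)
Definition rep_of : Rep Q R :=
  @Functor (path_category Q) (Mod R) V (fun i j p => path_map p)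
    (fun i => erefl) (fun i j k q p => path_map_cat q p).

Lemma phi_rep_of i : phi rep_of i = b i.
Proof.
apply: linear_ext; apply: (dsum_hom_ext (f := phi rep_of i) (g := b i)) => -[j a] x.
by rewrite [LHS]copair_inj.
Qed.

End RepOf.

Lemma fmap_qcons F (i j k : Q) (p : qpath i j) (a : arrow j k) x :
  fmap F (qcons p a : @Hom (path_category Q) i k) x =
  fmap F (arrow_path a) (fmap F (p : @Hom (path_category Q) i j) x).
Proof.
have -> : qcons p a = (arrow_path a : @Hom (path_category Q) j k) ∘ p by [].
by rewrite fmapM.
Qed.

Lemma nat_of_arrows F G (t : forall i : Q, {linear fobj F i -> fobj G i}) :
  (forall (j i : Q) (a : arrow j i) x,
    t i (fmap F (arrow_path a) x) = fmap G (arrow_path a) (t j x)) ->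
  exists s : Hom F G, forall i, component s i = t i.
Proof.
move=> tN.
have tN' (i j : path_category Q) (p : Hom i j) :
    (t j : @Hom (Mod R) _ _) ∘ fmap F p = fmap G p ∘ t i.
  apply: linear_ext => x; elim: p => [|j' k p IH a] /=.
    have -> : qnil i = idm (i : path_category Q) by [].
    by rewrite !fmap1.
  apply: (etrans (congr1 (t k) (fmap_qcons (F := F) p a x))); rewrite tN.
  apply: (etrans _ (esym (fmap_qcons (F := G) p a (t i x)))).
  exact: (congr1 (fmap G (arrow_path a)) IH).
by exists (NatTrans tN').
Qed.

Lemma naturality_at F G (s : Hom F G) (i j : path_category Q) (p : Hom i j) x :
  component s j (fmap F p x) = fmap G p (component s i x).
Proof. exact: (congr1 (fun f : {linear fobj F i -> fobj G j} => f x) (naturality s p)). Qed.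

Lemma phi_Tagged F (j i : Q) (a : arrow j i) x :
  phi F i (dsum_inj (fun a : arrows_to i => fobj F (tag a)) (Tagged (fun j => arrow j i) a) x) =
  fmap F (arrow_path a) x.
Proof. exact: copair_inj. Qed.

Lemma sub_rep G (K : Q -> lmodType R) (k : forall i, {linear K i -> fobj G i}) :
  (forall i, injective (k i)) ->
  (forall (j i : Q) (a : arrow j i) x, exists y, k i y = fmap G (arrow_path a) (k j x)) ->
  exists F (s : Hom F G), forall i, injective (component s i) /\
    forall x, (exists y, component s i y = x) <-> exists y, k i y = x.
Proof.
move=> kI kG.
have bP i : exists b : {linear dsum (fun a : arrows_to i => K (tag a)) -> K i},
    forall x, k i (b x) = phi G i (dsum_map (fun a : arrows_to i => k (tag a)) x).
  pose h (a : arrows_to i) := sval (cid (factor_inj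
    (f := (fmap G (arrow_path (tagged a)) : {linear _ -> _}) \o k (tag a)) (kI i)
    (kG _ _ (tagged a)))).
  have hP (a : arrows_to i) x : k i (h a x) = fmap G (arrow_path (tagged a)) (k (tag a) x).
    by rewrite /h; case: cid.
  exists (copair h).
  apply: (dsum_hom_ext (f := k i \o copair h)
    (g := phi G i \o dsum_map (fun a : arrows_to i => k (tag a)))) => -[j a] x.
  by rewrite [LHS]/= copair_inj hP [RHS]/= dsum_map_single phi_Tagged.
pose b i := sval (cid (bP i)).
have bE i x : k i (b i x) = phi G i (dsum_map (fun a : arrows_to i => k (tag a)) x).
  by rewrite /b; case: cid.
have [j i a x|s sE] := nat_of_arrows (F := rep_of b) (G := G) (t := k).
  rewrite [fmap (rep_of b) _ _]/= /arrow_map /= bE.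
  by rewrite [dsum_map _ _]dsum_map_single phi_Tagged.
by exists (rep_of b), s => i; rewrite sE; split.
Qed.

Lemma quotient_rep F (M : Q -> lmodType R) (q : forall i, {linear fobj F i -> M i}) :
  (forall i, onto (q i)) ->
  (forall (j i : Q) (a : arrow j i) x, q j x = 0 -> q i (fmap F (arrow_path a) x) = 0) ->
  exists G (s : Hom F G), forall i, onto (component s i) /\
    forall x, component s i x = 0 <-> q i x = 0.
Proof.
move=> qS qF.
pose h (j i : Q) (a : arrow j i) := sval (cid (factor_surj
    (f := q i \o (fmap F (arrow_path a) : {linear _ -> _})) (qS j) (qF _ _ a))).
have hP (j i : Q) (a : arrow j i) x : h j i a (q j x) = q i (fmap F (arrow_path a) x).
  by rewrite /h; case: cid.
pose b i : {linear dsum (fun a : arrows_to i => M (tag a)) -> M i} :=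
  copair (fun a : arrows_to i => h _ _ (tagged a)).
have [j i a x|s sE] := nat_of_arrows (F := F) (G := rep_of b) (t := q).
  by rewrite [fmap (rep_of b) _ _]/= /arrow_map /= copair_inj hP.
by exists (rep_of b), s => i; rewrite sE; split.
Qed.

Definition concrete_Rep : concrete R (Rep Q R).
Proof.
apply: (@Concrete R (Rep Q R) Q (fun i F => fobj F i) (fun i F G s => component s i)) => //.
- by move=> F G s t st; apply: nat_trans_ext => i; exact: linear_ext.
- move=> F G f.
  have [i|j i a x|K [k kP]] := sub_rep (G := F) (k := fun i => kernel_incl (component f i)).
  + exact: kernel_incl_inj.
  + apply/kernel_inclP; rewrite naturality_at.
    have /kernel_inclP -> : exists y,
        kernel_incl (component f j) y = kernel_incl (component f j) x by exists x.
    exact: linear0.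
  exists K, k => i; split; first exact: (kP i).1.
  by move=> x; rewrite (kP i).2; exact: kernel_inclP.
- move=> F G f.
  have [i|j i a x|K [k kP]] := quotient_rep (F := G) (q := fun i => coker_proj (component f i)).
  + exact: coker_proj_surj.
  + move=> /coker_projP[y <-]; apply/coker_projP.
    by exists (fmap F (arrow_path a) y); rewrite naturality_at.
  exists K, k => i; split; first exact: (kP i).1.
  by move=> x; rewrite (kP i).2; exact: coker_projP.
- move=> F G T k t kI kt.
  pose u i := sval (cid (factor_inj (kI i) (kt i))).
  have uP i x : component k i (u i x) = component t i x by rewrite /u; case: cid.
  have [j i a x|s sE] := nat_of_arrows (F := T) (G := F) (t := u).
    by apply: (kI i); rewrite uP !naturality_at uP.
  by exists s; apply: nat_trans_ext => i; apply: linear_ext => x; rewrite /= sE uP.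
- move=> F G T q t qS qt.
  pose u i := sval (cid (factor_surj (qS i) (qt i))).
  have uP i x : u i (component q i x) = component t i x by rewrite /u; case: cid.
  have [j i a y|s sE] := nat_of_arrows (F := G) (G := T) (t := u).
    by have [x <-] := qS j y; rewrite -naturality_at !uP naturality_at.
  by exists s; apply: nat_trans_ext => i; apply: linear_ext => x; rewrite /= sE uP.
- move=> F G; pose V i : lmodType R := (fobj F i * fobj G i)%type.
  pose c (i : Q) (a : arrows_to i) : {linear V (tag a) -> V i} :=
    into_pair ((fmap F (arrow_path (tagged a)) : {linear _ -> _}) \o @fst_lin R _ _)
      ((fmap G (arrow_path (tagged a)) : {linear _ -> _}) \o @snd_lin R _ _).
  pose b i : {linear dsum (fun a : arrows_to i => V (tag a)) -> V i} := copair (c i).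
  have bE (j i : Q) (a : arrow j i) x : fmap (rep_of b) (arrow_path a) x =
      (fmap F (arrow_path a) x.1, fmap G (arrow_path a) x.2).
    by rewrite [LHS]/= /arrow_map /= copair_inj.
  have [j i a x|s sE] := nat_of_arrows (F := F) (G := rep_of b) (t := fun i => @inl_lin R _ _).
    by rewrite bE /= linear0.
  have [j i a x|t tE] := nat_of_arrows (F := G) (G := rep_of b) (t := fun i => @inr_lin R _ _).
    by rewrite bE /= linear0.
  have [j i a x|s' sE'] := nat_of_arrows (F := rep_of b) (G := F) (t := fun i => @fst_lin R _ _).
    by rewrite bE.
  have [j i a x|t' tE'] := nat_of_arrows (F := rep_of b) (G := G) (t := fun i => @snd_lin R _ _).
    by rewrite bE.
  exists (rep_of b), s, t', t, s'; split.
  + by move=> i; rewrite sE tE'; exact: ses_pair.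
  + by apply: nat_trans_ext => i; rewrite /= tE tE'; exact: linear_ext.
  + by apply: nat_trans_ext => i; rewrite /= sE sE'; exact: linear_ext.
Defined.

End Representations.

(** * The snake lemma with injective right column *)

Section Snake.
Variables (R : pzRingType) (A0 B0 D0 A B D : lmodType R).
Variables (f0 : {linear A0 -> B0}) (g0 : {linear B0 -> D0}).
Variables (f : {linear A -> B}) (g : {linear B -> D}).
Variables (a : {linear A0 -> A}) (b : {linear B0 -> B}) (d : {linear D0 -> D}).
Hypotheses (fg0 : ses f0 g0) (fg : ses f g).
Hypotheses (fa : forall x, b (f0 x) = f (a x)) (gb : forall y, d (g0 y) = g (b y)).
Hypothesis dI : injective d.

Lemma snake_inj : injective a -> injective b.
Proof.
move=> aI; apply: inj_linear => y by0.
have /(ses_ker fg0)[x xy] : g0 y = 0 by apply: dI; rewrite gb by0 !linear0.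
have ax0 : a x = 0 by apply: (ses_inj fg); rewrite -fa xy by0 linear0.
by rewrite -xy (aI x 0) ?linear0.
Qed.

(** Since d has no kernel, the connecting homomorphism is zero and the sequence of cokernels is
    exact on the left too. *)
Lemma snake_coker : exists (u : {linear coker a -> coker b})
  (v : {linear coker b -> coker d}), ses u v.
Proof.
have [x|u uP] := factor_surj (f := coker_proj b \o f) (@coker_proj_surj _ _ _ a).
  by move=> /coker_projP[z <-]; apply/coker_projP; exists (f0 z).
have [y|v vP] := factor_surj (f := coker_proj d \o g) (@coker_proj_surj _ _ _ b).
  by move=> /coker_projP[z <-]; apply/coker_projP; exists (g0 z).
exists u, v; split.
- apply: inj_linear => x'; have [x <-] := coker_proj_surj x'; rewrite uP.
  move=> /coker_projP[y yx]; apply/coker_projP.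
  have /(ses_ker fg0)[z zy] : g0 y = 0.
    by apply: dI; rewrite gb yx linear0; exact: ses_comp fg x.
  by exists z; apply: (ses_inj fg); rewrite -fa zy.
- move=> z'; have [z <-] := coker_proj_surj z'; have [y <-] := ses_surj fg z.
  by exists (coker_proj b y); rewrite vP.
- move=> y'; have [y <-] := coker_proj_surj y'; rewrite vP => /coker_projP[z' /esym gy].
  have [z zz'] := ses_surj fg0 z'.
  have [|x fx] := ses_ker fg (y := y - b z).
    by rewrite linearB -gb zz' -gy subrr.
  exists (coker_proj a x); rewrite uP /= fx.
  apply/coker_piP; exists (- z); by rewrite linearN addrC addKr.
- move=> x'; have [x <-] := coker_proj_surj x'; rewrite uP vP.
  by apply/coker_projP; exists 0; rewrite linear0 [RHS](ses_comp fg).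
Qed.

End Snake.

(** * Closure properties of Phi *)

Section PhiClass.
Variables (Q : quiver) (R : pzRingType).
Implicit Types F G H : Rep Q R.
Implicit Type Y : lmodType R -> Prop.

Definition incoming F i : lmodType R := dsum (fun a : arrows_to i => fobj F (tag a)).

Definition incoming_map F G (s : Hom F G) i : {linear incoming F i -> incoming G i} :=
  dsum_map (fun a : arrows_to i => component s (tag a)).

Lemma phi_natural F G (s : Hom F G) i x :
  phi G i (incoming_map s i x) = component s i (phi F i x).
Proof.
apply: (dsum_hom_ext (f := phi G i \o incoming_map s i)
  (g := component s i \o phi F i)) => -[j a] y.
rewrite [LHS]/= [incoming_map _ _ _]dsum_map_single [LHS]phi_Tagged [RHS]/= phi_Tagged.
by rewrite naturality_at.
Qed.

Lemma PhiP Y F : Phi (Y : obj_class (Mod R)) F <->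
  forall i, injective (phi F i) /\ Y (coker_phi F i).
Proof.
have phiM i := pt_mono (concrete_Mod R) (phi F i).
split=> FY i; have [FI YF] := FY i; split=> //; first exact: ((phiM i).1 FI tt).
by apply: (phiM i).2 => -[].
Qed.

Lemma pses_incoming F G H (s : Hom F G) (t : Hom G H) i :
  pses (concrete_Rep Q R) s t -> ses (incoming_map s i) (incoming_map t i).
Proof. by move=> st; apply: dsum_map_ses => a; exact: st. Qed.

Lemma Phi_coker F G H (s : Hom F G) (t : Hom G H) i :
  pses (concrete_Rep Q R) s t -> injective (phi H i) ->
  exists (u : {linear coker_phi F i -> coker_phi G i})
    (v : {linear coker_phi G i -> coker_phi H i}), ses u v.
Proof.
move=> st HI; apply: (snake_coker (a := phi F i) (b := phi G i) (d := phi H i)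
  (pses_incoming i st) (st i)) => // x; exact: phi_natural.
Qed.

Lemma Phi_closed_extensions Y : ext_closed Y ->
  closed_extensions (Phi (Y : obj_class (Mod R)) : obj_class (Rep Q R)).
Proof.
move=> Ye F G H s t /(pses_short_exact (concrete_Rep Q R)) st /PhiP FY /PhiP HY.
apply/PhiP => i; have [FI YF] := FY i; have [HI YH] := HY i; split.
  apply: (snake_inj (a := phi F i) (b := phi G i) (d := phi H i)
    (pses_incoming i st) (st i)) => // x; exact: phi_natural.
by have [u [v uv]] := Phi_coker st HI; exact: Ye uv YF YH.
Qed.

Lemma Phi_closed_epi_kernels Y : ker_closed Y ->
  closed_epi_kernels (Phi (Y : obj_class (Mod R)) : obj_class (Rep Q R)).
Proof.
move=> Yk F G H s t /PhiP GY /PhiP HY tE sK.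
have /(pses_kernel (concrete_Rep Q R)) st := conj sK tE.
apply/PhiP => i; have [GI YG] := GY i; have [HI YH] := HY i; split.
  apply: inj_linear => x x0; apply: (ses_inj (pses_incoming i st)).
  by rewrite linear0; apply: GI; rewrite phi_natural x0 !linear0.
by have [u [v uv]] := Phi_coker st HI; exact: Yk uv YG YH.
Qed.

Lemma retract_at F G (s : Hom F G) (r : Hom G F) i x :
  r ∘ s = idm F -> component r i (component s i x) = x.
Proof. by move=> /(congr1 (fun t : nat_trans F F => component t i x)). Qed.

(** The incoming module and C_i are functorial, so they carry a retract of representations to a
    retract of modules. *)
Lemma Phi_closed_summands Y : retract_closed Y ->
  closed_summands (Phi (Y : obj_class (Mod R)) : obj_class (Rep Q R)).
Proof.
move=> Yr F G /direct_summand_retract[s [r rs]] /PhiP GY; apply/PhiP => i.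
have [GI YG] := GY i; split.
  apply: inj_linear => x x0.
  have sI : injective (incoming_map s i).
    apply: dsum_map_inj => a y z e.
    by rewrite -[y](retract_at y rs) -[z](retract_at z rs) e.
  by apply: sI; rewrite linear0; apply: GI; rewrite phi_natural x0 !linear0.
have [x|u uP] := factor_surj (f := coker_proj (phi G i) \o component s i)
    (@coker_proj_surj _ _ _ (phi F i)).
  move=> /coker_projP[z <-]; apply/coker_projP; exists (incoming_map s i z).
  exact: phi_natural.
have [x|v vP] := factor_surj (f := coker_proj (phi F i) \o component r i)
    (@coker_proj_surj _ _ _ (phi G i)).
  move=> /coker_projP[z <-]; apply/coker_projP; exists (incoming_map r i z).
  exact: phi_natural.
apply: (Yr _ _ u v) YG => x'; have [x <-] := coker_proj_surj x'.
by rewrite uP [LHS]vP; congr (coker_proj _ _); exact: retract_at.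
Qed.

Lemma Rep_class_closed_summands Y : retract_closed Y ->
  closed_summands (Rep_class (Y : obj_class (Mod R)) : obj_class (Rep Q R)).
Proof.
move=> Yr F G /direct_summand_retract[s [r rs]] GY i.
by apply: (Yr _ _ (component s i) (component r i)) (GY i) => x; exact: retract_at.
Qed.

End PhiClass.

(** * Recursion along a left rooted quiver *)

Section LeftRooted.
Variable Q : quiver.

Definition arrow_rel (j i : Q) := inhabited (arrow j i).

(** A vertex that is not accessible has a predecessor that is not accessible; dependent choice turns
    this into an infinite path running backwards. *)
Lemma left_rooted_wf : left_rooted Q -> well_founded arrow_rel.
Proof.
move=> Qlr i; apply: contrapT => iN.
have step (x : {i : Q | ~ Acc arrow_rel i}) :
    exists y : {i : Q | ~ Acc arrow_rel i}, arrow_rel (sval y) (sval x).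
  apply: contrapT => xN; apply: (svalP x); split=> y yx.
  by apply: contrapT => yA; apply: xN; exists (exist _ y yA).
have [v vP] := choice step.
apply: Qlr; exists (fun n => sval (iter n v (exist _ i iN))) => n; exact: vP.
Qed.

(* Well-founded recursion producing structures [x i] together with data [Step]
   relating [x i] to the structures at the sources of the arrows into [i]. *)
Lemma left_rooted_rec (T : Q -> Type)
    (Step : forall i : Q, (forall j, arrow_rel j i -> T j) -> T i -> Type) :
  left_rooted Q ->
  (forall i x, exists y, inhabited (Step i x y)) ->
  exists v : forall i, T i, inhabited (forall i, Step i (fun j _ => v j) (v i)).
Proof.
move=> /left_rooted_wf wf step.
pose next i x := sval (cid (step i x)).
pose v := Fix wf T next.
have vE i : v i = next i (fun j _ => v j).
  apply: Fix_eq => j x y xy; congr next.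
  by apply: functional_extensionality_dep => k; apply: functional_extensionality_dep => r.
exists v; have nextP i : inhabited (Step i (fun j _ => v j) (v i)).
  by rewrite vE /next; case: cid.
by constructor=> i; exact: inhabited_witness (nextP i).
Qed.

End LeftRooted.

(** * Lifting and projective covers of representations *)

Section Lifting.
Variables (Q : quiver) (R : pzRingType).
Hypothesis Qlr : left_rooted Q.
Implicit Types A B E F K P V : Rep Q R.

Lemma lifts_Rep A V :
  (forall i, injective (phi A i)) ->
  (forall i, ext1_zero (coker_phi A i) (fobj V i)) ->
  lifts (concrete_Rep Q R) A V.
Proof.
move=> AI AV E B k p kp g.
pose T i := {t : {linear fobj A i -> fobj E i} |
  forall x, component p i (t x) = component g i x}.
pose Step i (x : forall j, arrow_rel j i -> T j) (y : T i) :=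
  forall (j : Q) (a : arrow j i) z,
    sval y (fmap A (arrow_path a) z) = fmap E (arrow_path a) (sval (x j (inhabits a)) z).
have [|v [vP]] := @left_rooted_rec Q T Step Qlr.
  move=> i x.
  (* Compatibility with the arrows into i prescribes the lift on the image of [phi A i]. *)
  pose s : {linear incoming A i -> fobj E i} := copair (fun a : arrows_to i =>
    (fmap E (arrow_path (tagged a)) : {linear _ -> _}) \o
      sval (x (tag a) (inhabits (tagged a)))).
  have ps z : component p i (s z) = component g i (phi A i z).
    move: z; apply: (dsum_hom_ext (f := component p i \o s)
      (g := component g i \o phi A i)) => -[j a] z.
    rewrite [LHS]/= copair_inj /= naturality_at.
    by rewrite (svalP (x j (inhabits a))) phi_Tagged naturality_at.
  have [t [pt ts]] := ext1_extend_lift (AV i) (ses_coker (AI i)) (kp i) ps.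
  exists (exist _ t pt); constructor=> j a z /=.
  by rewrite -phi_Tagged ts [LHS]copair_inj.
have [j i a z|t tE] := nat_of_arrows (F := A) (G := E) (t := fun i => sval (v i)).
  exact: vP.
exists t; apply: nat_trans_ext => i; apply: linear_ext => x.
by rewrite /= tE; exact: (svalP (v i)).
Qed.

Lemma cprojective_Rep P :
  (forall i, injective (phi P i)) -> (forall i, projective (coker_phi P i)) ->
  cprojective (concrete_Rep Q R) P.
Proof.
move=> PI PC E B p pS g; have [K [k kp]] := onto_pses (U := concrete_Rep Q R) pS.
have PK : lifts (concrete_Rep Q R) P K.
  by apply: lifts_Rep => // i; exact/projective_ext1/PC.
exact: PK kp g.
Qed.

Lemma projective_retract (L M : lmodType R) (i : {linear L -> M}) (r : {linear M -> L}) :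
  (forall x, r (i x) = x) -> projective M -> projective L.
Proof.
move=> ri Mproj B C p g pS; have [h hP] := Mproj _ _ p (g \o r) pS.
by exists (h \o i) => x; rewrite /= hP /= ri.
Qed.

(** P(i) is the sum of the incoming module of P and a free module covering A(i), so phi_i is a
    summand inclusion with free cokernel up to isomorphism. *)
Lemma projective_cover A : exists P (p : Hom P A),
  (forall i, onto (component p i)) /\
  (forall i, injective (phi P i) /\ projective (coker_phi P i)).
Proof.
pose T i := {P : lmodType R & {linear P -> fobj A i}}.
(* The structure map b belongs to [Step] and not to [T], as its source depends on the modules
   already chosen at the sources of the arrows. *)
pose Step i (x : forall j, arrow_rel j i -> T j) (y : T i) :=
  {b : {linear dsum (fun a : arrows_to i => projT1 (x (tag a) (inhabits (tagged a))))
         -> projT1 y} |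
   [/\ onto (projT2 y), injective b, projective (coker b) &
    forall (j : Q) (a : arrow j i) z,
      projT2 y (b (dsum_inj _ (Tagged (fun j => arrow j i) a) z)) =
      fmap A (arrow_path a) (projT2 (x j (inhabits a)) z)]}.
have [|v [vP]] := @left_rooted_rec Q T Step Qlr.
  move=> i x.
  pose S := dsum (fun a : arrows_to i => projT1 (x (tag a) (inhabits (tagged a)))).
  pose F := free_mod R (fobj A i).
  pose q : {linear S -> fobj A i} := copair (fun a : arrows_to i =>
    (fmap A (arrow_path (tagged a)) : {linear _ -> _}) \o
      projT2 (x (tag a) (inhabits (tagged a)))).
  exists (existT (fun P : lmodType R => {linear P -> fobj A i}) (S * F)%type
    (pair_map q (@free_cover R (fobj A i)))).
  constructor; exists (@inl_lin R S F); split=> /=.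
  - move=> y; have [x' <-] := free_cover_surj y; exists (0, x').
    by rewrite /pair_map /= linear0 add0r.
  - exact: ses_inj (ses_pair S F).
  - have SF := ses_pair S F.
    have [z|h [hI hS]] := iso_of_ker (@coker_proj_surj _ _ _ (@inl_lin R S F)) (ses_surj SF).
      by rewrite coker_projP; split=> [[y <-]|/(ses_ker SF)].
    have [y|g gP] := factor_inj (f := idfun) hI; first exact: hS.
    apply: (projective_retract (i := h) (r := g)) (@free_projective R _) => y.
    by apply: hI; rewrite gP.
  - move=> j a z; rewrite /pair_map /= linear0 addr0.
    by rewrite [LHS]copair_inj.
pose P := rep_of (fun i => sval (vP i)).
have [j i a z|p pE] := nat_of_arrows (F := P) (G := A) (t := fun i => projT2 (v i)).
  by have [_ _ _ ->] := svalP (vP i).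
exists P, p; split=> i; have [qS bI bP _] := svalP (vP i); first by rewrite pE.
by rewrite /coker_phi phi_rep_of.
Qed.

(** F(i) is an extension of C_i(F) by the direct sum of the F(j) over the arrows into i, to which
    well-founded induction applies. *)
Lemma Phi_objects (Y : lmodType R -> Prop) F :
  ext_closed Y ->
  (forall (I : choiceType) (V : I -> lmodType R), (forall i, Y (V i)) -> Y (dsum V)) ->
  (forall i, injective (phi F i) /\ Y (coker_phi F i)) -> forall i, Y (fobj F i).
Proof.
move=> Ye Yd FY i; elim/(well_founded_ind (left_rooted_wf Qlr)): i => i IH.
have [FI YF] := FY i; apply: Ye (ses_coker FI) _ YF; apply: Yd => a.
by apply: IH; constructor; exact: (tagged a).
Qed.

End Lifting.

(** * The Frobenius pair of representations *)

Section Main.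
Variables (R : pzRingType) (Q : quiver) (m : nat) (X w : obj_class (Mod R)).
Hypothesis Qlr : left_rooted Q.
Hypothesis frob : frobenius_pair X w.
Hypothesis cot : complete_cotorsion_pair (resdim_le w m) (right_perp1 (resdim_le w m)).

Notation Y := (res_le (X : lmodType R -> Prop) m).
Notation W := (res_le (w : lmodType R -> Prop) m).

Let X_res : resolving X := frob_resolving frob cot.
Let Y_res : resolving Y := res_le_resolving m X_res.
Let W_cot := frob_cot frob cot.
Let ext1_YW (M V : lmodType R) : Y M -> W V -> ext1_perp W V -> ext1_zero M V.
Proof.
exact: (ext1_ab X_res (@frob_ext1 _ _ _ frob) (@frob_cogen_ses _ _ _ frob)).
Qed.

Lemma frobenius_envelope (A : Rep Q R) :
  (forall i, injective (phi A i) /\ Y (coker_phi A i)) ->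
  exists (V D : Rep Q R) (e : Hom A V) (q : Hom V D),
    [/\ pses (concrete_Rep Q R) e q,
        forall i, injective (phi V i) /\ W (coker_phi V i),
        forall i, ext1_perp W (fobj V i) &
        forall i, injective (phi D i) /\ Y (coker_phi D i)].
Proof.
move=> AY.
pose T i := {V : lmodType R & {e : {linear fobj A i -> V} |
  [/\ injective e, W V & ext1_perp W V]}}.
pose emb i (y : T i) : {linear fobj A i -> projT1 y} := sval (projT2 y).
(* The equivalence says that A(i) and the incoming module of V meet only in the incoming module of
   A; it yields both naturality of the embedding and injectivity of phi_i for the quotient D. The
   module N is to become C_i(D). *)
pose Step i (x : forall j, arrow_rel j i -> T j) (y : T i) :=
  {b : {linear dsum (fun a : arrows_to i => projT1 (x (tag a) (inhabits (tagged a))))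
         -> projT1 y} |
   [/\ injective b,
       forall z t, emb i y z = b t <-> exists s, phi A i s = z /\
         dsum_map (fun a : arrows_to i => emb (tag a) (x (tag a) (inhabits (tagged a)))) s = t,
       W (coker b) &
       exists (N : lmodType R) (q : {linear projT1 y -> N}), [/\ onto q, Y N &
          forall v, q v = 0 <-> exists z t, v = emb i y z + b t]]}.
have [|v [vP]] := @left_rooted_rec Q T Step Qlr.
  move=> i x; have [AI YA] := AY i.
  pose e := dsum_map (fun a : arrows_to i => emb (tag a) (x (tag a) (inhabits (tagged a)))).
  have eI : injective e.
    by apply: dsum_map_inj => a; case: (svalP (projT2 (x (tag a) (inhabits (tagged a))))).
  have WS : W (dsum (fun a : arrows_to i => projT1 (x (tag a) (inhabits (tagged a))))).
    apply: (cot_dsum W_cot) => a.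
    by case: (svalP (projT2 (x (tag a) (inhabits (tagged a))))).
  have [V [a [b [aI bI ab [WV pV] [[N [q [bq WN]]] N'P]]]]] :=
    envelope_step X_res (frob_ext1 frob) (frob_sub frob) (frob_cogen_ses frob)
      W_cot (frob_cot_envelope frob cot) (ses_coker AI) YA eI WS.
  exists (existT (fun V : lmodType R => {e : {linear fobj A i -> V} |
    [/\ injective e, W V & ext1_perp W V]}) V (exist _ a (And3 aI WV pV))).
  constructor; exists b; split=> //.
  have [z|h hI] := iso_of_ker (ses_surj bq) (@coker_proj_surj _ _ _ b).
    by rewrite coker_projP; split=> [/(ses_ker bq)|[y <-]] //; exact: ses_comp bq y.
  exact: retract_closed_iso (cot_retract_closed W_cot) hI WN.
pose V := rep_of (fun i => sval (vP i)).
have phiV i : phi V i = sval (vP i) by exact: phi_rep_of.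
have eN (j i : Q) (a : arrow j i) z :
    emb i (v i) (fmap A (arrow_path a) z) = fmap V (arrow_path a) (emb j (v j) z).
  rewrite [RHS]/= /arrow_map /=; have [_ bE _ _] := svalP (vP i); apply/bE.
  exists (dsum_inj (fun a : arrows_to i => fobj A (tag a)) (Tagged (fun j => arrow j i) a) z).
  by rewrite phi_Tagged dsum_map_single.
have [e eE] := nat_of_arrows (F := A) (G := V) eN.
have [D [q qP]] := ev_coker (concrete_Rep Q R) e.
have eq : pses (concrete_Rep Q R) e q.
  move=> i; have [qS qE] := qP i; split=> //.
  - by rewrite [evm _ _ _]eE; case: (svalP (projT2 (v i))).
  - by move=> y /qE.
  - by move=> x; apply/qE; exists x.
exists V, D, e, q; split=> // i.
- by rewrite /coker_phi phiV; have [bI _ Wb _] := svalP (vP i).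
- by have [_ _ pV] := svalP (projT2 (v i)).
have [bI bE _ [N [r [rS YN rE]]]] := svalP (vP i).
have rE' x : r x = 0 <-> exists z t, x = component e i z + phi V i t.
  by rewrite eE phiV; exact: rE.
have bE' z t : component e i z = phi V i t <->
    exists s, phi A i s = z /\ incoming_map e i s = t.
  have -> : incoming_map e i = dsum_map (fun a : arrows_to i => emb (tag a) (v (tag a))).
    by apply: linear_ext => x; apply: dsum_ext => a; rewrite /= eE.
  by rewrite eE phiV; exact: bE.
split.
  (* If phi_i of V sends z into the image of A(i), then z comes from the incoming module of A and so
     vanishes in that of D. *)
  apply: inj_linear => z'; have [z <-] := ses_surj (pses_incoming i eq) z'.
  rewrite phi_natural => /(ses_ker (eq i))[x /bE'[s [_ <-]]].
  exact: ses_comp (pses_incoming i eq) s.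
pose c : {linear fobj V i -> coker_phi D i} := coker_proj (phi D i) \o component q i.
have cS : onto c.
  move=> y; have [z <-] := coker_proj_surj y; have [x <-] := ses_surj (eq i) z.
  by exists x.
(* Both maps kill exactly the sum of the images of A(i) and of the incoming module of V, so C_i(D)
   is isomorphic to N. *)
have [x|h hI] := iso_of_ker rS cS.
  rewrite rE' coker_projP; split=> [[z [t ->]]|[z']].
    exists (incoming_map q i t); rewrite phi_natural linearD.
    by rewrite [component q i (component e i z)](ses_comp (eq i)) add0r.
  have [z <-] := ses_surj (pses_incoming i eq) z'; rewrite phi_natural => qz.
  have [|y yP] := ses_ker (eq i) (y := x - phi V i z).
    by rewrite linearB -[evm _ _ _ _]/(component q i _) -qz subrr.
  by exists y, z; rewrite [component e i y]yP subrK.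
exact: retract_closed_iso (res_retract Y_res) hI YN.
Qed.

Lemma Ext_zero_Phi (A V : Rep Q R) n :
  (forall i, injective (phi A i) /\ Y (coker_phi A i)) ->
  (forall i, W (fobj V i) /\ ext1_perp W (fobj V i)) -> (0 < n)%N -> Ext_zero n A V.
Proof.
move=> AY VW n0.
pose PY : obj_class (Rep Q R) := Phi (Y : obj_class (Mod R)).
apply: (@Ext_zero_of_lifts R (Rep Q R) (concrete_Rep Q R) PY) n0; last exact/PhiP.
  move=> F /PhiP FY; apply: lifts_Rep => // i; first exact: (FY i).1.
  by have [WV pV] := VW i; apply: ext1_YW => //; exact: (FY i).2.
move=> F FY; have [P [p [pS PP]]] := projective_cover Qlr F.
have [K [k kp]] := onto_pses (U := concrete_Rep Q R) pS.
exists K, P, k, p; split=> //.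
  by apply: cprojective_Rep => // i; [exact: (PP i).1|exact: (PP i).2].
have PYP : PY P.
  by apply/PhiP => i; split; [exact: (PP i).1|exact/(res_proj Y_res)/(PP i).2].
have [kK pE] := (pses_kernel (concrete_Rep Q R) k p).1 kp.
exact: (Phi_closed_epi_kernels (res_ker Y_res) PYP FY pE kK).
Qed.

End Main.

Theorem proposition5p6 (R : pzRingType) (Q : quiver) (m : nat)
    (X w : obj_class (Mod R)) :
  left_rooted Q ->
  frobenius_pair X w ->
  complete_cotorsion_pair (resdim_le w m) (right_perp1 (resdim_le w m)) ->
  @frobenius_pair (Rep Q R)
    (Phi (resdim_le X m))
    (fun F => Phi (resdim_le w m) F /\ Rep_class (right_perp1 (resdim_le w m)) F).
Proof.
move=> Qlr frob cot.
have X_res := frob_resolving frob cot.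
have Y_res := res_le_resolving m X_res.
have W_cot := frob_cot frob cot.
(* Equality of predicates, not just equivalence, allows the elementwise classes to be substituted
   inside [Phi] and [Rep_class]. *)
have W_perp : right_perp1 (resdim_le w m) = ext1_perp (res_le w m) :> obj_class (Mod R).
  by apply: funext => N; apply: propext; exact: (right_perp1_Mod m frob N).
have W_res : resdim_le w m = res_le w m :> obj_class (Mod R).
  apply: funext => N; apply: propext; apply: resdim_le_Mod.
  exact: closed_summands_Mod (frob_summandsw frob).
have -> : resdim_le X m = res_le X m :> obj_class (Mod R).
  by apply: funext => N; apply: propext; exact: resdim_le_Mod (res_retract X_res).
rewrite W_perp W_res {W_perp W_res}.
have perp_retract : retract_closed (ext1_perp (res_le w m)).
  by move=> A B i r ri pB L WL; apply: ext1_retract_r ri _; exact: pB.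
have W_retract := cot_retract_closed W_cot.
split.
- exact: Phi_closed_extensions (res_ext Y_res).
- exact: Phi_closed_epi_kernels (res_ker Y_res).
- exact: Phi_closed_summands (res_retract Y_res).
- move=> F G FG [WG pG]; split; first exact: Phi_closed_summands W_retract _ _ FG WG.
  exact: Rep_class_closed_summands perp_retract _ _ FG pG.
- move=> A V n /PhiP AY [/PhiP VW pV] n0; apply: (Ext_zero_Phi Qlr frob cot) => // i.
  split; last exact: pV.
  (* Membership in Phi(W) constrains only the cokernels; that the modules V(i) are themselves in W
     comes from the recursion over the quiver. *)
  apply: (Phi_objects Qlr (cot_ext_closed W_cot)) => // I V'; exact: cot_dsum.
- move=> F [/PhiP FW _]; apply/PhiP => i; have [FI WF] := FW i; split=> //.
  exact: (res_le_w_X (frob_sub frob)).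
- move=> A /PhiP /(frobenius_envelope Qlr frob cot)[V [D [e [q [eq VW pV DY]]]]].
  exists V, D, e, q; split; last exact/PhiP.
    exact/(pses_short_exact (concrete_Rep Q R)).
  by split; [exact/PhiP|exact: pV].
Qed.
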